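(* Let $\alpha:=a_H/M_H\in[0,1)$ and let $\Omega$ be the open set of four-tuples $(m,E,L_z,L)$ satisfying $$m>0,\quad L>L_{ms}(\alpha,\beta),\quad E_{min}(\alpha,\beta,L)<E<\min\{m,E_{max}(\alpha,\beta,L)\},\quad L_z=\beta L+a_HE\neq0,$$ for some $\beta\in(-1,1)$. Then, for every $(m,E,L_z,L)\in\Omega$, the set $\Gamma_{m,E,L_z,L}$ has a unique connected component which lies entirely in the exterior region $r>r_+$, and this component has topology $\mathbb R\times T^3$.
   Context: Kerr spacetime. Fix $M_H>0$ and $a_H$ with $a_H^2<M_H^2$. Put $\Delta(r)=r^2-2M_Hr+a_H^2$, $\rho^2=r^2+a_H^2\cos^2\vartheta$, $r_\pm=M_H\pm\sqrt{M_H^2-a_H^2}$. $(M,g)$ is the region $r>r_-$ of Kerr in horizon-penetrating coordinates $(t,r,\vartheta,\varphi)$ (with $t\in\mathbb R$, $\varphi$ $2\pi$-periodic, $0<\vartheta<\pi$; the axis $\vartheta=0,\pi$ is only a coordinate singularity), $g=-dt^2+dr^2-2a_H\sin^2\vartheta\,dr\,d\varphi+(r^2+a_H^2)\sin^2\vartheta\,d\varphi^2+\rho^2d\vartheta^2+\frac{2M_Hr}{\rho^2}(dt+dr-a_H\sin^2\vartheta\,d\varphi)^2$, time-oriented so that $-\nabla t$ is future-directed. $\Gamma\subset T^*M$ is the set of $(x,p)$ such that $p^\sharp=g_x^{-1}(p,\cdot)$ is future-directed timelike; $(x^\mu,p_\mu)$ are canonical coordinates. $H=\frac12g_x^{-1}(p,p)=\frac1{2\rho^2}[-(\rho^2+2M_Hr)p_t^2+4M_Hrp_tp_r+2a_Hp_rp_\varphi+\Delta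 p_r^2+p_\vartheta^2+\frac{p_\varphi^2}{\sin^2\vartheta}]$. $F_0=-H$, $F_1=-p_t$, $F_2=p_\varphi$, $F_3=p_\vartheta^2+(\frac{p_\varphi}{\sin\vartheta}+a_H\sin\vartheta\,p_t)^2-2a_H^2\cos^2\vartheta\,H$. $\Gamma_{m,E,L_z,L}:=\{(x,p)\in\Gamma:F_0=m^2/2,\ F_1=E,\ F_2=L_z,\ F_3=L^2\}$. Definition of $L_{ms},E_{min},E_{max}$. For $\beta\in(-1,1)$ and $x>x_+:=1+\sqrt{1-\alpha^2}$ put $h(x)=x(x-3)+2\alpha^2(1-\beta^2)+2\alpha\beta\sqrt{x-\alpha^2(1-\beta^2)}$; $h$ has a unique zero $x_{ph}>x_+$, and $h>0$ on $(x_{ph},\infty)$. For $x>x_{ph}$ put $\lambda_{sph}(x)=x\frac{\sqrt{x-\alpha^2(1-\beta^2)}-\alpha\beta}{\sqrt{h(x)}}$ and $\varepsilon_{sph}(x)=\frac{x^2-2x+\alpha^2(1-\beta^2)+\alpha\beta\sqrt{x-\alpha^2(1-\beta^2)}}{x\sqrt{h(x)}}$. $\lambda_{sph}$ has a unique minimizer $x_{ms}$ on $(x_{ph},\infty)$; $\lambda_{ms}=\lambda_{sph}(x_{ms})$. For $\lambda>\lambda_{ms}$ the equation $\lambda_{sph}(x)=\lambda$ has exactly two solutions $x_{max}\in(x_{ph},x_{ms})$, $x_{min}\in(x_{ms},\infty)$; $\varepsilon_{max}=\varepsilon_{sph}(x_{max})$, $\varepsilon_{min}=\varepsilon_{sph}(x_{min})$.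 Then $L_{ms}:=M_Hm\,\lambda_{ms}$, and $E_{max}:=m\,\varepsilon_{max}$, $E_{min}:=m\,\varepsilon_{min}$ evaluated at $\lambda=L/(M_Hm)$. *)

(* Defs.v *)
From mathcomp Require Import all_boot all_order all_algebra.
From mathcomp Require Import all_classical all_reals all_analysis.

Set Implicit Arguments.
Unset Strict Implicit.
Unset Printing Implicit Defensive.

Import Order.TTheory GRing.Theory Num.Theory.
Import numFieldNormedType.Exports.

Local Open Scope classical_set_scope.
Local Open Scope ring_scope.

(** ** Topology *)

Definition is_component (X : topologicalType) (A C : set X) : Prop :=
  exists2 x, A x & C = connected_component A x.

(* [A] and [B] carry the subspace topology. *)
Definition homeomorphic (X Y : topologicalType) (A : set X) (B : set Y) : Prop :=
  exists (f : X -> Y) (g : Y -> X),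
    [/\ {within A, continuous f} /\ {within B, continuous g},
        forall x, A x -> B (f x),
        forall y, B y -> A (g y),
        forall x, A x -> g (f x) = x &
        forall y, B y -> f (g y) = y].

Definition circle (R : realType) : set (R * R) :=
  [set u | u.1 ^+ 2 + u.2 ^+ 2 = 1].

Definition R_times_T3 (R : realType) : set (R * (R * R) * (R * R) * (R * R)) :=
  [set: R] `*` @circle R `*` @circle R `*` @circle R.

(** ** Phase space

   A phase point is [(t, r, theta, u, p)], where the 2 pi-periodic angle phi is
   represented by [u = (cos phi, sin phi)] on the unit circle and
   [p = (p_t, p_r, p_theta, p_phi)]. This covers the cotangent bundle away from
   the axis of rotation. At an axis point the vector field d/dphi vanishes, so
   p_phi = 0 there: level sets with L_z <> 0 do not meet the axis. *)

Definition phase (R : realType) : Type := (R * R * R * (R * R) * 'rV[R]_4)%type.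

Section Coordinates.
Context {R : realType}.
Implicit Type z : phase R.

Definition it : 'I_4 := @Ordinal 4 0 isT.
Definition ir : 'I_4 := @Ordinal 4 1 isT.
Definition ith : 'I_4 := @Ordinal 4 2 isT.
Definition iph : 'I_4 := @Ordinal 4 3 isT.

Definition radius z : R := z.1.1.1.2.
Definition theta z : R := z.1.1.2.
Definition phi_pt z : R * R := z.1.2.
Definition momentum z : 'rV[R]_4 := z.2.

Definition p_t z : R := momentum z 0 it.
Definition p_th z : R := momentum z 0 ith.
Definition p_ph z : R := momentum z 0 iph.

(* The coordinate 1-forms, as row vectors. *)
Definition dt : 'rV[R]_4 := delta_mx 0 it.
Definition dr : 'rV[R]_4 := delta_mx 0 ir.
Definition dth : 'rV[R]_4 := delta_mx 0 ith.
Definition dph : 'rV[R]_4 := delta_mx 0 iph.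

(* The symmetric product of 1-forms, (v (x) w + w (x) v) / 2, as a Gram matrix. *)
Definition symprod (v w : 'rV[R]_4) : 'M[R]_4 :=
  2^-1 *: (v^T *m w + w^T *m v).

End Coordinates.

(** ** The Kerr metric, with mass [M] and rotation parameter [a] *)

Section Kerr.
Context {R : realType}.
Variables M a : R.

Definition r_plus : R := M + Num.sqrt (M ^+ 2 - a ^+ 2).
Definition r_minus : R := M - Num.sqrt (M ^+ 2 - a ^+ 2).

Definition rho2 (r th : R) : R := r ^+ 2 + a ^+ 2 * cos th ^+ 2.

Definition metric (r th : R) : 'M[R]_4 :=
  let k := dt + dr - (a * sin th ^+ 2) *: dph in
  - symprod dt dt + symprod dr dr
  - (2 * a * sin th ^+ 2) *: symprod dr dph
  + ((r ^+ 2 + a ^+ 2) * sin th ^+ 2) *: symprod dph dph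
  + rho2 r th *: symprod dth dth
  + (2 * M * r / rho2 r th) *: symprod k k.

Definition cometric (r th : R) : 'M[R]_4 := invmx (metric r th).

(* Tangent vectors, like covectors, are row vectors of components. *)
Definition inner (r th : R) (v w : 'rV[R]_4) : R :=
  (v *m metric r th *m w^T) 0 0.

Definition sharp (r th : R) (p : 'rV[R]_4) : 'rV[R]_4 := p *m cometric r th.

Definition grad_t (r th : R) : 'rV[R]_4 := sharp r th dt.

(* Signature (-,+,+,+), time-oriented by [- grad_t]. *)
Definition future_timelike (r th : R) (v : 'rV[R]_4) : Prop :=
  inner r th v v < 0 /\ inner r th v (- grad_t r th) < 0.

Definition Gamma : set (phase R) :=
  [set z | [/\ r_minus < radius z, 0 < theta z < pi, circle (phi_pt z) &
     future_timelike (radius z) (theta z)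
       (sharp (radius z) (theta z) (momentum z))]].

Definition hamiltonian (z : phase R) : R :=
  2^-1 * (momentum z *m cometric (radius z) (theta z) *m (momentum z)^T) 0 0.

Definition F0 (z : phase R) : R := - hamiltonian z.
Definition F1 (z : phase R) : R := - p_t z.
Definition F2 (z : phase R) : R := p_ph z.
Definition F3 (z : phase R) : R :=
  p_th z ^+ 2 + (p_ph z / sin (theta z) + a * sin (theta z) * p_t z) ^+ 2
  - 2 * a ^+ 2 * cos (theta z) ^+ 2 * hamiltonian z.

Definition Gamma_level (m E Lz L : R) : set (phase R) :=
  [set z | Gamma z /\
     [/\ F0 z = m ^+ 2 / 2, F1 z = E, F2 z = Lz & F3 z = L ^+ 2]].

Definition exterior : set (phase R) := [set z | r_plus < radius z].

End Kerr.

(** ** Spherical orbits, in the dimensionless variable x = r / M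

   [get P] picks an element of [P]; each set it is applied to below is a
   singleton for 0 <= alpha < 1, -1 < beta < 1 (and, for [x_max] and [x_min],
   lambda > [lambda_ms]). *)

Section Spherical.
Context {R : realType}.
Variables alpha beta : R.

Definition x_plus : R := 1 + Num.sqrt (1 - alpha ^+ 2).

Definition sph_root (x : R) : R :=
  Num.sqrt (x - alpha ^+ 2 * (1 - beta ^+ 2)).

Definition h_sph (x : R) : R :=
  x * (x - 3) + 2 * alpha ^+ 2 * (1 - beta ^+ 2)
  + 2 * alpha * beta * sph_root x.

Definition x_ph : R := get [set x | x_plus < x /\ h_sph x = 0].

Definition lambda_sph (x : R) : R :=
  x * (sph_root x - alpha * beta) / Num.sqrt (h_sph x).

Definition eps_sph (x : R) : R :=
  (x ^+ 2 - 2 * x + alpha ^+ 2 * (1 - beta ^+ 2) + alpha * beta * sph_root x)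
  / (x * Num.sqrt (h_sph x)).

Definition x_ms : R :=
  get [set x | x_ph < x /\
               forall y, x_ph < y -> lambda_sph x <= lambda_sph y].

Definition lambda_ms : R := lambda_sph x_ms.

Definition x_max (lambda : R) : R :=
  get [set x | x_ph < x < x_ms /\ lambda_sph x = lambda].

Definition x_min (lambda : R) : R :=
  get [set x | x_ms < x /\ lambda_sph x = lambda].

Definition eps_max (lambda : R) : R := eps_sph (x_max lambda).
Definition eps_min (lambda : R) : R := eps_sph (x_min lambda).

End Spherical.

Section Omega.
Context {R : realType}.
Variables M a : R.
Let alpha := a / M.

Definition L_ms (m beta : R) : R := M * m * lambda_ms alpha beta.

Definition E_max (m beta L : R) : R := m * eps_max alpha beta (L / (M * m)).
Definition E_min (m beta L : R) : R := m * eps_min alpha beta (L / (M * m)).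

Definition Omega : set (R * R * R * R) :=
  [set q | let: (m, E, Lz, L) := q in
     exists beta : R, [/\ -1 < beta < 1, 0 < m, L_ms m beta < L,
       E_min m beta L < E < Num.min m (E_max m beta L) &
       Lz = beta * L + a * E /\ Lz != 0]].

End Omega.

(* Main.v *)
(** On a level set the constants of motion separate: [p_r] solves a quadratic
    equation whose discriminant [radR] is a quartic in [r], and
    [(sin theta * p_theta)^2 = polT (cos^2 theta)] with [polT] quadratic.
    [polT] is convex, positive at 0 and negative at 1, so the polar motion is
    one closed curve around a simple root [u0] of [polT].

    The radial quartic is nonnegative at both horizons, negative at infinity
    (as [E < m]), positive at [M x_min] (as [E > E_min]) and negative at some
    [g] between the outer horizon and [M x_min]: at [M x_max], where
    [E < E_max], or at the zero of [radP] beyond it. Hence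
    [radR r = (r - r1) (r2 - r) G r] with [g < r1 < r2] and [G] a convex
    quadratic, positive on [[g, oo)] and nonpositive at the outer horizon.
    The part [r > g] of the level set is thus a line times three circles, and it
    is a whole component because the level set has no point with [r = g].

    A point with [r_+ < r < g] lies on an arc of the radial curve that turns
    back at a root of [G] and whose ingoing branch
    [p_r = radC / (radQ + sqrt radR)] extends to [r = r_+], so its component
    leaves the exterior.

    Of the spherical orbits one only needs that [x_ph], [x_ms], [x_max] and
    [x_min] exist, and not that they are unique. *)

Require Import Defs.
From mathcomp Require Import all_boot all_order all_algebra.
From mathcomp Require Import all_classical all_reals all_analysis.
From mathcomp Require Import ring lra.
Import Order.TTheory GRing.Theory Num.Theory.
Import numFieldNormedType.Exports.
Local Open Scope classical_set_scope.
Local Open Scope ring_scope.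
Set Implicit Arguments.
Unset Strict Implicit.
Unset Printing Implicit Defensive.

(* [radius] also names a function of MathComp-Analysis. *)
Local Notation radius := Defs.radius.

(** * Limits of composite functions *)

Section ContinuousComposition.
Variables (R : realType) (T : Type) (F : set_system T).
Context {FF : Filter F}.
Variables (f : T -> R) (l : R).
Hypothesis fl : f x @[x --> F] --> l.

Lemma cvg_exprn n : f x ^+ n @[x --> F] --> l ^+ n.
Proof. exact: (@continuous_cvg _ _ _ F FF f (fun x : R => x ^+ n) l
  (@exprn_continuous R n l) fl). Qed.

Lemma cvg_sqrt : Num.sqrt (f x) @[x --> F] --> Num.sqrt l.
Proof. exact: (@continuous_cvg _ _ _ F FF f Num.sqrt l
  (@sqrt_continuous R l) fl). Qed.

Lemma cvg_cos : cos (f x) @[x --> F] --> cos l.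
Proof. exact: (@continuous_cvg _ _ _ F FF f cos l
  (@continuous_cos R l) fl). Qed.

Lemma cvg_sin : sin (f x) @[x --> F] --> sin l.
Proof. exact: (@continuous_cvg _ _ _ F FF f sin l
  (@continuous_sin R l) fl). Qed.
End ContinuousComposition.

Lemma cvg_pair_pt (X Y : topologicalType) (T : Type) (F : set_system T)
    {FF : Filter F} (f : T -> X) (g : T -> Y) (a : X) (b : Y) :
  f x @[x --> F] --> a -> g x @[x --> F] --> b ->
  (f x, g x) @[x --> F] --> (a, b).
Proof. by move=> fa gb; exact: (cvg_pair fa gb). Qed.

(** Follows the shape of the function. What is left to the caller is that denominators do not vanish
    and the limits of subterms whose head is not recognised. *)
Ltac cvg_tac :=
  lazymatch goal with
  | |- cvg_to (nbhs (fmap (fun _ => ?c) _)) _ => exact: cvg_cst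
  | |- cvg_to (nbhs (fmap (fun x => x) _)) _ => exact: cvg_id
  | |- cvg_to (nbhs (fmap (fun x => @?f x + - @?g x) _)) _ => apply: cvgB;
    cvg_tac
  | |- cvg_to (nbhs (fmap (fun x => @?f x + @?g x) _)) _ => apply: cvgD; cvg_tac
  | |- cvg_to (nbhs (fmap (fun x => - @?f x) _)) _ => apply: cvgN; cvg_tac
  | |- cvg_to (nbhs (fmap (fun x => @?f x * @?g x) _)) _ => apply: cvgM; cvg_tac
  | |- cvg_to (nbhs (fmap (fun x => @?f x ^-1) _)) _ => apply: cvgV; [|cvg_tac]
  | |- cvg_to (nbhs (fmap (fun x => @?f x ^+ _) _)) _ => apply: cvg_exprn;
    cvg_tac
  | |- cvg_to (nbhs (fmap (fun x => Num.sqrt (@?f x)) _)) _ => apply: cvg_sqrt;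
    cvg_tac
  | |- cvg_to (nbhs (fmap (fun x => cos (@?f x)) _)) _ => apply: cvg_cos;
    cvg_tac
  | |- cvg_to (nbhs (fmap (fun x => sin (@?f x)) _)) _ => apply: cvg_sin;
    cvg_tac
  | |- cvg_to (nbhs (fmap (GRing.mul _) _)) _ =>
      apply: cvgM; [exact: cvg_cst | exact: cvg_id]
  | |- cvg_to (nbhs (fmap (fun x => (@?f x, @?g x)) _)) _
    => apply: cvg_pair_pt; cvg_tac
  | |- _ => idtac
  end.

(** * The inverse metric *)

Section Mat.
Variable R : realType.
Implicit Types (M a r th : R).

(** The inverse of [metric] in closed form, its entries being the coefficients of the quadratic form
    [2 * hamiltonian]. *)
Definition cometric_mx M a r th : 'M[R]_4 :=
  let p := rho2 a r th in
  \matrix_(i < 4, j < 4) match (i : nat), (j : nat) with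
  | 0%N, 0%N => - (1 + 2 * M * r / p)
  | 0%N, 1%N | 1%N, 0%N => 2 * M * r / p
  | 1%N, 1%N => (r ^+ 2 - 2 * M * r + a ^+ 2) / p
  | 1%N, 3%N | 3%N, 1%N => a / p
  | 2%N, 2%N => p^-1
  | 3%N, 3%N => (p * sin th ^+ 2)^-1
  | _, _ => 0
  end.

Lemma symprodE (v w : 'rV[R]_4) i j :
  symprod v w i j = 2^-1 * (v 0 i * w 0 j + w 0 i * v 0 j).
Proof. by rewrite !mxE !big_ord1 !mxE. Qed.

Lemma invmx_uniq n (A B : 'M[R]_n) : A *m B = 1%:M -> invmx A = B.
Proof.
move=> AB; have [Au _] := mulmx1_unit AB.
by rewrite -[LHS]mulmx1 -AB mulmxA mulVmx // mul1mx.
Qed.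

Lemma forall_ord4 (P : 'I_4 -> Prop) :
  P it -> P ir -> P ith -> P iph -> forall i, P i.
Proof.
move=> P0 P1 P2 P3 [[|[|[|[|//]]]] lti].
- by rewrite (_ : Ordinal _ = it) //; exact: val_inj.
- by rewrite (_ : Ordinal _ = ir) //; exact: val_inj.
- by rewrite (_ : Ordinal _ = ith) //; exact: val_inj.
- by rewrite (_ : Ordinal _ = iph) //; exact: val_inj.
Qed.

Lemma sum_ord4 (F : 'I_4 -> R) :
  \sum_i F i = F it + F ir + F ith + F iph.
Proof.
rewrite !big_ord_recl big_ord0 addr0 !addrA.
by congr (_ + _ + _ + _); congr (F _); apply: val_inj.
Qed.

Lemma rho2_gt0 a r th : 0 < r -> 0 < rho2 a r th.
Proof. by move=> r0;
  rewrite /rho2 ltr_wpDr ?exprn_gt0// mulr_ge0// sqr_ge0. Qed.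


Definition metric_mx M a r th : 'M[R]_4 :=
  let p := rho2 a r th in let s := sin th ^+ 2 in let f := 2 * M * r / p in
  \matrix_(i < 4, j < 4) match (i : nat), (j : nat) with
  | 0%N, 0%N => f - 1
  | 0%N, 1%N | 1%N, 0%N => f
  | 0%N, 3%N | 3%N, 0%N => - (f * a * s)
  | 1%N, 1%N => 1 + f
  | 1%N, 3%N | 3%N, 1%N => - (a * s * (1 + f))
  | 2%N, 2%N => p
  | 3%N, 3%N => (r ^+ 2 + a ^+ 2) * s + f * a ^+ 2 * s ^+ 2
  | _, _ => 0
  end.

Lemma metricE M a r th : metric M a r th = metric_mx M a r th.
Proof.
apply/matrixP; apply: forall_ord4; apply: forall_ord4;
  rewrite !(mxE, symprodE, big_ord1) /= ?mulr1n ?mulr0n.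
all: move: (2 * M * r / _) => f; move: (rho2 a r th) (sin th ^+ 2) => p s.
all: by field.
Qed.

Lemma metric_mul_cometric M a r th : 0 < r -> 0 < th < pi ->
  metric M a r th *m cometric_mx M a r th = 1%:M.
Proof.
move=> r0 th0; rewrite metricE.
have s0 : sin th ^+ 2 != 0 by rewrite expf_neq0// gt_eqF// sin_gt0_pi.
have p0 : rho2 a r th != 0 by rewrite gt_eqF// rho2_gt0.
have pE : rho2 a r th = r ^+ 2 + a ^+ 2 * (1 - sin th ^+ 2).
  by rewrite /rho2 cos2sin2.
apply/matrixP; apply: forall_ord4; apply: forall_ord4;
  rewrite mxE sum_ord4 !mxE /= ?mulr0 ?mul0r ?mulr1n ?mulr0n ?addr0 ?add0r /=.
all: move: (rho2 a r th) (sin th ^+ 2) s0 p0 pE => p s s0 p0 pE.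
(* Eliminating [r ^+ 2] in favour of [rho2] and [sin th ^+ 2] builds the relation between the three
   into the entries, so that each entry becomes a rational identity. *)
all: have rE : r ^+ 2 = p - a ^+ 2 * (1 - s) by rewrite pE; ring.
all: rewrite ?rE.
all: try by [].
all: by field; rewrite ?p0 ?s0.
Qed.

Lemma cometricE M a r th : 0 < r -> 0 < th < pi ->
  cometric M a r th = cometric_mx M a r th.
Proof. by move=> r0 th0; apply/invmx_uniq/metric_mul_cometric. Qed.

Lemma tr_cometric_mx M a r th : (cometric_mx M a r th)^T = cometric_mx M a r th.
Proof.
by apply/matrixP; apply: forall_ord4; apply: forall_ord4; rewrite !mxE.
Qed.
End Mat.

(** * The Hamiltonian and the future cone in coordinates *)

Section Ham.
Variable R : realType.
Implicit Types (M a r th : R) (p q : 'rV[R]_4) (z : phase R).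

(* The paper's Delta. *)
Definition horizon M a r : R := r ^+ 2 - 2 * M * r + a ^+ 2.

Definition p_r z : R := momentum z 0 ir.

(** One factor of the inverse metric cancels the metric; the other one is symmetric. *)
Lemma inner_sharp M a r th p q : 0 < r -> 0 < th < pi ->
  inner M a r th (sharp M a r th p) (sharp M a r th q) =
  (p *m cometric_mx M a r th *m q^T) 0 0.
Proof.
move=> r0 th0; rewrite /inner /sharp cometricE//.
have g1 := mulmx1C (metric_mul_cometric M a r0 th0).
by rewrite trmx_mul -(mulmxA p) g1 mulmx1 mulmxA tr_cometric_mx.
Qed.

Lemma cometric_formE M a r th p q : 0 < r -> 0 < th < pi ->
  (p *m cometric_mx M a r th *m q^T) 0 0 =
  (rho2 a r th)^-1 * (- (rho2 a r th + 2 * M * r) * (p 0 it * q 0 it)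
   + 2 * M * r * (p 0 it * q 0 ir + p 0 ir * q 0 it)
   + horizon M a r * (p 0 ir * q 0 ir)
   + a * (p 0 ir * q 0 iph + p 0 iph * q 0 ir)
   + p 0 ith * q 0 ith + p 0 iph * q 0 iph / sin th ^+ 2).
Proof.
move=> r0 th0; rewrite mxE sum_ord4 !mxE !sum_ord4 !mxE /= ?mulr0 ?mul0r ?addr0
  ?add0r.

have s0 : sin th ^+ 2 != 0 by rewrite expf_neq0// gt_eqF// sin_gt0_pi.
have p0 : rho2 a r th != 0 by rewrite gt_eqF// rho2_gt0.
rewrite /horizon; move: (rho2 a r th) (sin th ^+ 2) s0 p0 => rho s s0 rho0.
by field; rewrite s0 rho0.
Qed.

Lemma hamiltonianE M a z : 0 < radius z -> 0 < theta z < pi ->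
  2 * rho2 a (radius z) (theta z) * hamiltonian M a z =
  - (rho2 a (radius z) (theta z) + 2 * M * radius z) * p_t z ^+ 2
  + 4 * M * radius z * p_t z * p_r z + horizon M a (radius z) * p_r z ^+ 2
  + 2 * a * p_r z * p_ph z + p_th z ^+ 2 + p_ph z ^+ 2 / sin (theta z) ^+ 2.
Proof.
move=> r0 th0; rewrite /hamiltonian cometricE// cometric_formE//.
have := rho2_gt0 a (theta z) r0 => /gt_eqF/negbT p0.
rewrite /p_t /p_r /p_ph /p_th.
move: (rho2 _ _ _) p0 ((sin _ ^+ 2)^-1) => rho rho0 s.
by field; rewrite rho0.
Qed.

(** Since [- grad_t] is the sharp of [- dt], both conditions of [future_timelike] become values of
    the cometric, on the pairs (p, p) and (p, - dt). *)
Lemma future_timelikeE M a z : 0 < radius z -> 0 < theta z < pi ->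
  future_timelike M a (radius z) (theta z)
    (sharp M a (radius z) (theta z) (momentum z)) <->
  hamiltonian M a z < 0 /\
  0 < 2 * M * radius z * p_r z
      - (rho2 a (radius z) (theta z) + 2 * M * radius z) * p_t z.
Proof.
move=> r0 th0; rewrite /future_timelike -[- grad_t _ _ _ _]mulNmx
  !inner_sharp//.
have rho0 := rho2_gt0 a (theta z) r0.
rewrite /hamiltonian cometricE// pmulr_rlt0 ?invr_gt0//.
rewrite (_ : (_ *m (- dt)^T) 0 0 =
  - ((rho2 a (radius z) (theta z))^-1 * (2 * M * radius z * p_r z
     - (rho2 a (radius z) (theta z) + 2 * M * radius z) * p_t z))).
  by rewrite oppr_lt0 pmulr_rgt0 ?invr_gt0.
by rewrite cometric_formE// /p_r /p_t !mxE /=; ring.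
Qed.

End Ham.

(** * Separation of the equations of a level set *)

Section Level.
Variables (R : realType) (M a m E beta L : R).
Let Lz := beta * L + a * E.

(* The level set is cut out by
     [horizon r * p_r^2 - 2 * radQ r * p_r + radC r = 0],
   with discriminant [4 * radR r], and by
     [(sin theta * p_theta)^2 = polT (cos^2 theta)];
   [radP] is the usual [E (r^2 + a^2) - a L_z]. *)
Definition radP (r : R) := E * r ^+ 2 - a * beta * L.
Definition radQ (r : R) := 2 * M * r * E - a * Lz.
Definition radC (r : R) := L ^+ 2 + m ^+ 2 * r ^+ 2
  - (r ^+ 2 + a ^+ 2 + 2 * M * r) * E ^+ 2 + 2 * a * Lz * E.
Definition radR (r : R) :=
  radP r ^+ 2 - horizon M a r * (m ^+ 2 * r ^+ 2 + L ^+ 2).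
Definition polT (u : R) :=
  (L ^+ 2 - a ^+ 2 * m ^+ 2 * u) * (1 - u) - (beta * L + a * E * u) ^+ 2.

Lemma radPE r : radP r = radQ r + E * horizon M a r.
Proof. by rewrite /radP /radQ /Lz /horizon; ring. Qed.

Lemma radRE r : radR r = radQ r ^+ 2 - horizon M a r * radC r.
Proof. by rewrite /radR /radP /radQ /radC /Lz /horizon; ring. Qed.

(** Inserting [hamiltonian = - m ^+ 2 / 2] into [F3 = L ^+ 2] gives the polar equation. Eliminating
    [p_th] with it from the Hamiltonian equation leaves one in [r] and [p_r] alone. *)
Lemma Gamma_levelP (z : phase R) : 0 < m -> 0 <= r_minus M a ->
  Gamma_level M a m E Lz L z <->
  [/\ r_minus M a < radius z, 0 < theta z < pi, circle (phi_pt z),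
      p_t z = - E /\ p_ph z = Lz &
      [/\ sin (theta z) ^+ 2 * p_th z ^+ 2 = polT (cos (theta z) ^+ 2),
        horizon M a (radius z) * p_r z ^+ 2 - 2 * radQ (radius z) * p_r z
          + radC (radius z) = 0 &
        0 < 2 * M * radius z * p_r z
            + (rho2 a (radius z) (theta z) + 2 * M * radius z) * E]].
Proof.
move=> m0 rm0; rewrite /Gamma_level /Gamma /F0 /F1 /F2 /F3 /=.
split.
  move=> [[r1 th0 cu fut] [H0 pt ph K]].
  have r0 := le_lt_trans rm0 r1.
  have s0 := sin_gt0_pi th0.
  have pt' : p_t z = - E by rewrite -pt opprK.
  have := hamiltonianE M a r0 th0.
  have HE : hamiltonian M a z = - (m ^+ 2 / 2) by rewrite -H0 opprK.
  move: fut => /(future_timelikeE _ _ r0 th0)[_].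
  move: K; rewrite HE pt' ph /rho2 /horizon => K fut H1.
  have cs := cos2sin2 (theta z).
  split => //; split.
  - by rewrite /polT -K cs /Lz; field; rewrite gt_eqF.
  - move/eqP: H1; rewrite -subr_eq0 => /eqP H1.
    transitivity (- 0 : R); last by rewrite oppr0.
    by rewrite -[in RHS]H1 /radQ /radC -K cs /Lz; field; rewrite gt_eqF.
  - by move: fut; rewrite mulrN opprK.
move=> [r1 th0 cu [pt ph] [T1 R1 fut]].
have r0 := le_lt_trans rm0 r1.
have s0 := sin_gt0_pi th0.
have rho0 := rho2_gt0 a (theta z) r0.
have cs := cos2sin2 (theta z).
have HE : hamiltonian M a z = - (m ^+ 2 / 2).
  have rho1 : 2 * rho2 a (radius z) (theta z) != 0 by rewrite gt_eqF// mulr_gt0.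
  apply: (mulfI rho1); rewrite hamiltonianE// pt ph.
  apply/eqP; rewrite -subr_eq0; apply/eqP.
  (* The defect of the Hamiltonian equation is that of the radial equation plus that of the polar
     one divided by [sin theta ^+ 2]. *)
  transitivity (horizon M a (radius z) * p_r z ^+ 2 - 2 * radQ
    (radius z) * p_r z
    + radC (radius z) + (sin (theta z) ^+ 2 * p_th z ^+ 2
      - polT (cos (theta z) ^+ 2)) / sin (theta z) ^+ 2); last first.
    by rewrite R1 T1 subrr mul0r addr0.
  rewrite /polT /radQ /radC /rho2 /horizon cs /Lz.
  by field; rewrite gt_eqF.
split; first split => //.
  apply/(future_timelikeE _ _ r0 th0); split.
    by rewrite HE oppr_lt0 divr_gt0// exprn_gt0.
  by rewrite pt mulrN opprK.
split => //; [by rewrite HE opprK|by rewrite pt opprK|].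
apply/eqP; rewrite -subr_eq0; apply/eqP.
transitivity ((sin (theta z) ^+ 2 * p_th z ^+ 2 - polT (cos (theta z) ^+ 2)) /
  sin (theta z) ^+ 2); last by rewrite T1 subrr mul0r.
by rewrite HE pt ph /polT cs /Lz; field; rewrite gt_eqF.
Qed.
End Level.

(** * Spherical orbits *)

Section Sph.
Variables (R : realType) (al be : R).
Hypotheses (al_ge0 : 0 <= al) (al_lt1 : al < 1) (be_gt : -1 < be)
  (be_lt : be < 1).
Implicit Types x y : R.
Let k := al * be.
Let n := al ^+ 2 * (1 - be ^+ 2).
Let s := sph_root al be.
Let h := h_sph al be.
Let lam := lambda_sph al be.
Let D x := x ^+ 2 - 2 * x + al ^+ 2.
Let xp := x_plus al.
Let xph := x_ph al be.

Lemma ltr_of_sqr (u v : R) : 0 <= v -> u ^+ 2 < v ^+ 2 -> u < v.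
Proof. by move=> v0 uv; rewrite ltNge; apply/negP => vu; nra. Qed.

Let kn : n = al ^+ 2 - k ^+ 2. Proof. by rewrite /n /k; ring. Qed.
Let al2 : al ^+ 2 < 1. Proof. by rewrite -(expr1n _ 2) ltr_sqr// nnegrE. Qed.
Let be2 : be ^+ 2 < 1. Proof. by move: be_gt be_lt => b1 b2; nra. Qed.
Let n_ge0 : 0 <= n. Proof. by rewrite /n mulr_ge0 ?sqr_ge0// subr_ge0 ltW. Qed.
Let k2 : k ^+ 2 <= al ^+ 2. Proof. by move: n_ge0; rewrite kn subr_ge0. Qed.

Lemma sph_root_sqr x : 1 < x -> s x ^+ 2 = x - n.
Proof. by move: al2 => a2 x1; rewrite sqr_sqrtr// -/n kn; nra. Qed.

Lemma sph_root_gt0 x : 1 < x -> 0 < s x.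
Proof. by move: al2 => a2 x1; rewrite sqrtr_gt0 -/n kn; nra. Qed.

Lemma sph_root_gt x : 1 < x -> k < s x.
Proof.
move=> x1; apply: ltr_of_sqr; first exact/ltW/sph_root_gt0.
by rewrite sph_root_sqr// kn; move: al2 => a2; nra.
Qed.

(** Follows from [s x ^+ 2 = x - n] by completing the square. As [k < s x], the sign of [h] outside
    the horizon is that of [sqrt (D x) - (s x - k)]. *)
Lemma h_sphE x : 1 < x -> h x = D x - (s x - k) ^+ 2.
Proof.
move=> x1; rewrite /h /h_sph -/(s x) -(mulrA 2 al be) -/k -(mulrA 2
  (al^+2)) -/n.
have -> : D x - (s x - k) ^+ 2 = x ^+ 2 - 2 * x + al ^+ 2 - s x ^+ 2
  + 2 * k * s x - k ^+ 2 by rewrite /D; ring.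
by rewrite sph_root_sqr// kn; ring.
Qed.

Lemma x_plus_gt1 : 1 < xp.
Proof. by rewrite ltrDl sqrtr_gt0 subr_gt0. Qed.

Lemma x_plus_le2 : xp <= 2.
Proof.
have : Num.sqrt (1 - al ^+ 2) ^+ 2 = 1 - al ^+ 2 by
  rewrite sqr_sqrtr// subr_ge0 ltW.
by rewrite /xp /x_plus; move: (sqrtr_ge0 (1 - al ^+ 2)) (sqr_ge0 al) => ? ? ?;
  nra.
Qed.

Lemma D_x_plus : D xp = 0.
Proof.
have : Num.sqrt (1 - al ^+ 2) ^+ 2 = 1 - al ^+ 2 by
  rewrite sqr_sqrtr// subr_ge0 ltW.
rewrite /D /xp /x_plus; move: (Num.sqrt _) => w w2.
have -> : al ^+ 2 = 1 - w ^+ 2 by rewrite w2; ring.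
by ring.
Qed.

Lemma D_gt0 x : xp < x -> 0 < D x.
Proof.
move=> xpx; rewrite -D_x_plus -subr_gt0.
have -> : D x - D xp = (x - xp) * (x + xp - 2) by rewrite /D; ring.
by apply: mulr_gt0; have := x_plus_gt1; lra.
Qed.

Lemma h_x_plus_lt0 : h xp < 0.
Proof.
have xp1 := x_plus_gt1; rewrite h_sphE// D_x_plus sub0r oppr_lt0.
by rewrite exprn_gt0// subr_gt0 sph_root_gt.
Qed.

(** The value is [4 + 2 * n + 2 * k * s 4], where [k > -1] and [0 < s 4 <= 2] keep the last term
    above -4. With the negative value at [xp] this brackets the photon orbit. *)
Lemma h_sph4_gt0 : 0 < h 4.
Proof.
have x1 : (1 : R) < 4 by lra.
have := sph_root_sqr x1; have := sph_root_gt0 x1.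
rewrite /h /h_sph -/(s 4) -(mulrA 2 al be) -/k -(mulrA 2 (al^+2)) -/n => s0 s2.
have k1 : -1 < k by rewrite /k; move: al_ge0 al_lt1 be_gt => a0 a1 b1; nra.
move: n_ge0 => n0; have s4 : s 4 <= 2 by nra.
nra.
Qed.

Lemma h_sph_continuous : continuous h.
Proof. by move=> x; rewrite /continuous_at /h /h_sph /sph_root /=; cvg_tac. Qed.

Lemma x_phP : xp < xph /\ h xph = 0.
Proof.
suff : exists x, [set x | xp < x /\ h x = 0] x by move/getPex.
have h0 := h_x_plus_lt0; have h4 := h_sph4_gt0; have xp2 := x_plus_le2.
have [|||c] := @IVT R h xp 4 0.
- by lra.
- exact/continuous_subspaceT/h_sph_continuous.
- by rewrite ge_min le_max (ltW h0) (ltW h4) orbT.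
rewrite in_itv/= => /andP[xpc _] hc; exists c; split => //.
by rewrite lt_neqAle xpc andbT; apply: contra_eq_neq hc => <-; rewrite lt_eqF.
Qed.

Lemma sph_root_lt x y : 1 < x -> x < y -> s x < s y.
Proof. by move=> x1 xy; rewrite ltr_sqrt ?ltrD2r// -/n kn; move: al2 => a2;
  nra. Qed.

(* For [k <= 0] the quotient [h x / s x ^+ 2] is increasing. *)
Lemma h_sph_gt0_neg x y : k <= 0 -> xp < x -> x < y -> h x = 0 -> 0 < h y.
Proof.
move=> k0 xpx xy hx; have x1 := lt_trans x_plus_gt1 xpx;
  have y1 := lt_trans x1 xy.
have := sph_root_gt0 x1; have := sph_root_lt x1 xy.
have := sph_root_sqr x1; have := sph_root_sqr y1; have := sph_root_gt x1.
have kn' := kn; have kk := k2; have aa := al2; have n0 := n_ge0.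
move: hx; rewrite !h_sphE// /D.
move: (s x) (s y) => u v hx ku v2 u2 uv u0.
have hx' : (u ^+ 2 + n) ^+ 2 - 2 * (u ^+ 2 + n) + al ^+ 2 - (u - k) ^+ 2 = 0.
  by rewrite u2 -hx; ring.
have -> : y = v ^+ 2 + n by rewrite v2; ring.
set hy := (X in 0 < X).
have u2gt : 1 - n < u ^+ 2 by lra.
have uvgt : u ^+ 2 < v ^+ 2 by lra.
suff : 0 < u ^+ 2 * hy by rewrite pmulr_rgt0// exprn_gt0.
(* The difference of [u ^+ 2 * h y] and [v ^+ 2 * h x] splits into a product that is positive
   because [1 - n < u ^+ 2 < v ^+ 2], and one with the factor [- k * (v - u)]. *)
have -> : u ^+ 2 * hy = (v ^+ 2 - u ^+ 2) *
  (u ^+ 2 * v ^+ 2 - ((1 - n) ^+ 2 - (1 - al ^+ 2)))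
  + (v * (u - k) - u * (v - k)) * (v * (u - k) + u * (v - k)) + v ^+ 2 *
  ((u ^+ 2 + n) ^+ 2 - 2 * (u ^+ 2 + n) + al ^+ 2 - (u - k) ^+ 2).
  by rewrite /hy; ring.
rewrite hx' mulr0 addr0 ltr_pwDl//.
  rewrite mulr_gt0 ?subr_gt0//.
  have k20 := sqr_ge0 k.
  have : (1 - n) ^+ 2 <= u ^+ 2 * v ^+ 2 by rewrite [leLHS]expr2 ler_pM; lra.
  lra.
rewrite mulr_ge0//.
  by rewrite (_ : _ - _ = (- k) * (v - u)) ?mulr_ge0//; [lra|lra|ring].
by rewrite addr_ge0// mulr_ge0//; lra.
Qed.

(* For [0 <= k], [h] has the sign of [(k + sqrt (D x)) ^+ 2 - s x ^+ 2], which
   equals [y ^+ 2 - y - 2 * c + 2 * k * sqrt (y ^+ 2 - c)] with [y = x - 1] and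
   [c = 1 - al ^+ 2]; divided by [y] it is increasing. *)
Lemma h_sph_gt0_pos x y : 0 <= k -> xp < x -> x < y -> h x = 0 -> 0 < h y.
Proof.
move=> k0 xpx xy hx; have x1 := lt_trans x_plus_gt1 xpx;
  have y1 := lt_trans x1 xy.
have := sph_root_gt y1; have := sph_root_sqr x1; have := sph_root_sqr y1.
have := sph_root_gt x1.
have kn' := kn; have kk := k2; have aa := al2; have n0 := n_ge0.
have Dx0 := D_gt0 xpx; have Dy0 := D_gt0 (lt_trans xpx xy).
have [wx [wx0 wx2]] : exists w : R, 0 < w /\ w ^+ 2 = D x.
  by exists (Num.sqrt (D x)); rewrite sqrtr_gt0 sqr_sqrtr// ltW.
have [wy [wy0 wy2]] : exists w : R, 0 < w /\ w ^+ 2 = D y.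
  by exists (Num.sqrt (D y)); rewrite sqrtr_gt0 sqr_sqrtr// ltW.
move: hx wx2 wy2; rewrite !h_sphE//.
have -> : D x = (x - 1) ^+ 2 - (1 - al ^+ 2) by rewrite /D; ring.
have -> : D y = (y - 1) ^+ 2 - (1 - al ^+ 2) by rewrite /D; ring.
move: (s x) (s y) => u v hx wx2 wy2 ku v2 u2 kv.
(* At a zero of [h] the two nonnegative numbers [sqrt (D x)] and [s x - k] have equal squares. *)
have wxE : wx = u - k by (apply/eqP; rewrite -(@eqrXn2 _ 2)//;
  [apply/eqP; lra | lra | lra]).
rewrite -wy2 subr_gt0 ltr_sqr ?nnegrE; [|lra|lra].
rewrite ltrBlDr; apply: ltr_of_sqr; first lra.
have [c cE] : exists c, c = 1 - al ^+ 2 by exists (1 - al ^+ 2).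
rewrite -cE in wx2 wy2; have c0 : 0 <= c by lra.
have hx2 : (x - 1) ^+ 2 - (x - 1) - 2 * c + 2 * k * wx = 0.
  have -> : 2 * k * wx = 2 * (u * k) - 2 * k ^+ 2 by rewrite wxE; ring.
  lra.
(* The quotient of [sqrt (D x)] by [x - 1] is nondecreasing, because [D x = (x - 1) ^+ 2 - c] with
   [0 <= c]. *)
have wxy : wx * (y - 1) <= wy * (x - 1).
  rewrite -ler_sqr ?nnegrE ?mulr_ge0//; [|lra..].
  rewrite !exprMn wx2 wy2 -subr_ge0.
  by rewrite (_ : _ - _ = c * ((y - x) * (y + x - 2))) ?mulr_ge0//;
    [lra|lra|ring].
suff : 0 < (x - 1) * ((y - 1) ^+ 2 - (y - 1) - 2 * c + 2 * k * wy).
  by rewrite pmulr_rgt0; [have := v2; nra|lra].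
have -> : (x - 1) * ((y - 1) ^+ 2 - (y - 1) - 2 * c + 2 * k * wy) =
  (y - 1) * ((x - 1) ^+ 2 - (x - 1) - 2 * c + 2 * k * wx)
  + ((y - x) * ((x - 1) * (y - 1) + 2 * c)
    + 2 * k * (wy * (x - 1) - wx * (y - 1))) by ring.
rewrite hx2 mulr0 add0r ltr_pwDl//.
  by rewrite mulr_gt0 ?subr_gt0// ltr_pwDl ?mulr_gt0 ?mulr_ge0 ?subr_gt0.
by apply: mulr_ge0; [apply: mulr_ge0|rewrite subr_ge0].
Qed.

Lemma h_sph_gt0 x : xph < x -> 0 < h x.
Proof.
have [xpx hx] := x_phP; move=> xphx.
by have [k0|k0] := leP k 0; [apply: h_sph_gt0_neg hx|apply: h_sph_gt0_pos hx;
  rewrite ?ltW].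
Qed.

Lemma x_ph_gt1 : 1 < xph.
Proof. by have [xpx _] := x_phP; apply: lt_trans xpx; exact: x_plus_gt1. Qed.

Lemma lambda_sph_gt0 x : xph < x -> 0 < lam x.
Proof.
move=> xphx; have x1 := lt_trans x_ph_gt1 xphx.
have x0 := lt_trans ltr01 x1.
by rewrite divr_gt0 ?sqrtr_gt0 ?h_sph_gt0// mulr_gt0// subr_gt0 sph_root_gt.
Qed.

Lemma lambda_sph_continuous x : xph < x -> {for x, continuous lam}.
Proof.
move=> xphx; have hx := h_sph_gt0 xphx.
rewrite /prop_for /continuous_at /lam /lambda_sph /sph_root /=.
apply: cvgM; first by cvg_tac.
apply: cvgV; first by rewrite gt_eqF// sqrtr_gt0.
by apply: continuous_cvg; [exact: sqrt_continuous|exact: h_sph_continuous].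
Qed.

(** The denominator of [lam] tends to 0 at [xph], while the increasing numerator stays above its
    positive value there. *)
Lemma lambda_sph_near K : exists2 y, xph < y &
  forall x, xph < x -> x <= y -> K < lam x.
Proof.
have [xpx hx0] := x_phP; have xph1 := x_ph_gt1.
pose c := xph * (s xph - k).
have c0 : 0 < c by rewrite mulr_gt0 ?subr_gt0 ?sph_root_gt// (lt_trans ltr01).
pose K' := Num.max K 1; have K'0 : 0 < K' by rewrite lt_max ltr01 orbT.
have hc : h x @[x --> xph] --> (0 : R) by rewrite -hx0; exact: h_sph_continuous.
have e0 : 0 < (c / K') ^+ 2 by rewrite exprn_gt0// divr_gt0.
have /nbhs_ballP[d /= d0 hd] : nbhs xph [set t | h t < (c / K') ^+ 2].
  exact: cvgr_lt hc _ e0.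
exists (xph + d / 2); first by rewrite ltrDl divr_gt0.
move=> x xphx xd; have x1 := lt_trans xph1 xphx.
have hx : h x < (c / K') ^+ 2.
  apply: hd; rewrite /ball/= ltr_norml; apply/andP; split; lra.
have h0 := h_sph_gt0 xphx.
apply: (@le_lt_trans _ _ K'); first by rewrite le_max lexx.
rewrite ltr_pdivlMr ?sqrtr_gt0//.
have sh : Num.sqrt (h x) < c / K'.
  rewrite -ltr_sqr ?nnegrE ?sqrtr_ge0//; last by rewrite ltW// divr_gt0.
  by rewrite sqr_sqrtr// ltW.
apply: (@lt_le_trans _ _ c); first by rewrite mulrC -ltr_pdivlMr.
have ss := sph_root_lt xph1 xphx.
by apply: ler_pM; rewrite ?subr_ge0 ?lerD2r ?(ltW ss) ?(ltW xphx)//;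
  [lra|rewrite ltW// sph_root_gt].
Qed.

(** Since [sqrt (h x) <= x], [lam x] is at least [s x - k], which grows like the square root of
    [x]. *)
Lemma lambda_sph_far K : exists2 y, xph < y & forall x, y <= x -> K < lam x.
Proof.
have xph1 := x_ph_gt1.
pose K' := Num.max K 0.
have K'0 : 0 <= K' by rewrite le_max lexx orbT.
(* As [n < 1] and [k < 1], the second bound gives [s x > K' + 1] and hence [s x - k > K']. *)
exists (Num.max (xph + 1) ((K' + 1) ^+ 2 + 2)).
  by rewrite lt_max ltrDl ltr01.
move=> x; rewrite ge_max => /andP[xphx xK].
have xphx' : xph < x by lra.
have x1 := lt_trans xph1 xphx'.
have h0 := h_sph_gt0 xphx'.
apply: (@le_lt_trans _ _ K'); first by rewrite le_max lexx.
rewrite ltr_pdivlMr ?sqrtr_gt0//.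
have aa := al2; have n0 := n_ge0; have kk := k2; have s2 := sph_root_sqr x1.
have s0 := sph_root_gt0 x1.
have nlt : n < 1 by rewrite kn; have := sqr_ge0 k; lra.
have k1 : k < 1 by apply: ltr_of_sqr; lra.
have sK : K' + 1 < s x by apply: ltr_of_sqr; lra.
have hx : Num.sqrt (h x) <= x.
  rewrite -ler_sqr ?nnegrE ?sqrtr_ge0//; last lra.
  rewrite sqr_sqrtr ?(ltW h0)// /h /h_sph -/(s x) -(mulrA 2 al be) -/k.
  rewrite -(mulrA 2 (al^+2)) -/n.
  have x2 : 2 < x by have := sqr_ge0 (K' + 1); lra.
  have : 2 * (k * s x) <= k ^+ 2 + s x ^+ 2.
    by rewrite -subr_ge0 (_ : _ - _ = (k - s x) ^+ 2) ?sqr_ge0//; ring.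
  lra.
apply: (@le_lt_trans _ _ (K' * x)); first by rewrite ler_wpM2l.
by rewrite mulrC -/(s x) -/k ltr_pM2l; lra.
Qed.

(** Near [xph] and far out [lam] exceeds its value at [xph + 1], so its minimum over the compact
    interval in between is global. *)
Lemma x_msP : xph < x_ms al be /\ forall y, xph < y -> lam
  (x_ms al be) <= lam y.
Proof.
suff : exists x, [set x | xph < x /\ forall y, xph < y -> lam x <= lam y] x.
  by move/getPex.
have [y0 xy0 near0] := lambda_sph_near (lam (xph + 1)).
have [y1 xy1 far1] := lambda_sph_far (lam (xph + 1)).
have c1 : xph < xph + 1 by rewrite ltrDl.
have b0 : y0 < xph + 1.
  by rewrite ltNge; apply/negP => /(near0 _ c1); rewrite ltxx.
have b1 : xph + 1 < y1.
  by rewrite ltNge; apply/negP => /far1; rewrite ltxx.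
have [||c cin cmin] := @EVT_min R lam y0 y1; first lra.
  apply: continuous_in_subspaceT => x; rewrite inE/= in_itv/= => /andP[y0x _].
  by apply: lambda_sph_continuous; apply: lt_le_trans y0x.
move: cin; rewrite in_itv/= => /andP[c0 c2].
have cm : lam c <= lam (xph + 1) by apply: cmin; rewrite in_itv/= !ltW.
exists c; split => [|y xphy]; first exact: lt_le_trans c0.
have [yy0|y0y] := leP y y0; first exact/(le_trans cm)/ltW/near0.
have [y1y|yy1] := leP y1 y; first exact/(le_trans cm)/ltW/far1.
by apply: cmin; rewrite in_itv/= !ltW.
Qed.

(** On the way from [xph] to [x_ms] the function [lam] passes from values above [l] to
    [lambda_ms]. *)
Lemma x_maxP l : lambda_ms al be < l ->
  (xph < x_max al be l /\ x_max al be l < x_ms al be) /\ lam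
    (x_max al be l) = l.
Proof.
move=> lml.
suff : exists x, [set x | xph < x < x_ms al be /\ lam x = l] x.
  by move/getPex => [/andP[? ?] ?].
have [xms _] := x_msP; have [y0 xy0 near0] := lambda_sph_near l.
have y0ms : y0 < x_ms al be.
  by rewrite ltNge; apply/negP => /(near0 _ xms); rewrite ltNge (ltW lml).
have [|||c] := @IVT R lam y0 (x_ms al be) l; first exact: ltW.
- apply: continuous_in_subspaceT => x; rewrite inE/= in_itv/= => /andP[y0x _].
  by apply: lambda_sph_continuous; apply: lt_le_trans y0x.
- rewrite ge_min le_max; apply/andP; split; apply/orP.
    by right; exact: ltW lml.
  by left; exact/ltW/near0.
rewrite in_itv/= => /andP[y0c cms] lc; exists c; split => //.
rewrite (lt_le_trans xy0 y0c)/= lt_neqAle cms andbT.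
by apply: contraTneq lml => cE; rewrite -lc cE ltxx.
Qed.

Lemma x_minP l : lambda_ms al be < l ->
  x_ms al be < x_min al be l /\ lam (x_min al be l) = l.
Proof.
move=> lml.
suff : exists x, [set x | x_ms al be < x /\ lam x = l] x by move/getPex.
have [xms _] := x_msP; have [y1 xy1 far1] := lambda_sph_far l.
have msy1 : x_ms al be < y1.
  by rewrite ltNge; apply/negP => /far1; rewrite ltNge (ltW lml).
have [|||c] := @IVT R lam (x_ms al be) y1 l; first exact: ltW.
- apply: continuous_in_subspaceT => x; rewrite inE/= in_itv/= => /andP[y0x _].
  by apply: lambda_sph_continuous; apply: lt_le_trans y0x.
- rewrite ge_min le_max; apply/andP; split; apply/orP.
    by left; exact: ltW lml.
  by right; exact/ltW/far1.
rewrite in_itv/= => /andP[msc cy1] lc; exists c; split => //.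
rewrite lt_neqAle msc andbT.
by apply: contraTneq lml => cE; rewrite -lc -cE ltxx.
Qed.

(* The radial potential with energy [eps_sph x] and angular momentum [lam x]
   vanishes at [x], and there [radP] is positive. *)
Lemma sph_orbit x : xph < x ->
  [/\ 0 < eps_sph al be x, 0 < eps_sph al be x * x ^+ 2 - k * lam x &
    (eps_sph al be x * x ^+ 2 - k * lam x) ^+ 2 = D x * (x ^+ 2 + lam x ^+ 2)].
Proof.
move=> xphx; have x1 := lt_trans x_ph_gt1 xphx; have x0 := lt_trans ltr01 x1.
have h0 := h_sph_gt0 xphx; have hE := h_sphE x1; have s2 := sph_root_sqr x1.
have [xpx _] := x_phP; have D0 := D_gt0 (lt_trans xpx xphx).
have [w [w0 w2 wE]] : exists w : R, [/\ 0 < w, w ^+ 2 = h x & w = Num.sqrt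
  (h x)].
  by exists (Num.sqrt (h x)); rewrite sqrtr_gt0 sqr_sqrtr// ltW.
have wn0 : w != 0 by rewrite gt_eqF.
(* In this form the energy is visibly positive, as [1 < x] and [0 < h x]. *)
have eE : eps_sph al be x = (h x + x ^+ 2 - x) / (2 * x * w).
  rewrite /eps_sph -/(h x) -wE -/(s x) -/k -/n.
  have -> : x ^+ 2 - 2 * x + n + k * s x = (h x + x ^+ 2 - x) / 2.
    have -> : h x = D x - (x - n) + 2 * k * s x - k ^+ 2 by rewrite hE -s2;
      ring.
    by rewrite /D kn; field.
  by field; rewrite wn0 gt_eqF.
have PE : eps_sph al be x * x ^+ 2 - k * lam x = x * D x / w.
  rewrite eE /lam /lambda_sph -/(h x) -/(s x) -wE hE.
  rewrite -/k (_ : (s x - k) ^+ 2 = x - al ^+ 2 + 2 * k ^+ 2 - 2 * k * s x).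
    by rewrite /D; field; rewrite wn0 gt_eqF.
  have -> : x - al ^+ 2 = s x ^+ 2 - k ^+ 2 by rewrite s2 kn; ring.
  by ring.
have P0 : 0 < x * D x / w by rewrite divr_gt0 ?mulr_gt0.
split; rewrite ?PE// ?eE.
  rewrite divr_gt0 ?mulr_gt0// -addrA ltr_pwDl// subr_ge0 expr2 ler_peMl; lra.
have -> : x ^+ 2 + lam x ^+ 2 = x ^+ 2 * D x / w ^+ 2.
  have -> : D x = w ^+ 2 + (s x - k) ^+ 2 by rewrite w2 hE; ring.
  rewrite /lam /lambda_sph -/(h x) -/(s x) -wE -/k.
  by field; rewrite wn0.
by field; rewrite wn0.
Qed.
End Sph.

(** * The radial and polar potentials *)

Section KerrScaling.
Variables (R : realType) (M a : R).
Hypotheses (M0 : 0 < M) (al01 : 0 <= a / M < 1).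
Let al := a / M.

Lemma r_plus_scale : r_plus M a = M * x_plus al.
Proof.
rewrite /r_plus /x_plus mulrDr mulr1; congr (_ + _).
have -> : M ^+ 2 - a ^+ 2 = M ^+ 2 * (1 - al ^+ 2).
  by rewrite /al; field; rewrite gt_eqF.
by rewrite sqrtrM ?sqr_ge0// sqrtr_sqr gtr0_norm.
Qed.

(** Passage to the dimensionless variables [r / M], [E / m] and [L / (M * m)] of the spherical
    orbits. *)
Lemma radP_scale (m E beta L x : R) : 0 < m ->
  radP a E beta L (M * x) =
  m * M ^+ 2 * (E / m * x ^+ 2 - al * beta * (L / (M * m))).
Proof.
by move=> m0; rewrite /radP /al; field; rewrite !gt_eqF.
Qed.

Lemma radR_scale (m E beta L x : R) : 0 < m ->
  radR M a m E beta L (M * x) = m ^+ 2 * M ^+ 4 *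
  ((E / m * x ^+ 2 - al * beta * (L / (M * m))) ^+ 2
   - (x ^+ 2 - 2 * x + al ^+ 2) * (x ^+ 2 + (L / (M * m)) ^+ 2)).
Proof.
by move=> m0; rewrite /radR (radP_scale _ _ _ _ m0) /horizon /al; field;
  rewrite !gt_eqF.
Qed.

Lemma Omega_data (m E Lz L : R) : Omega M a (m, E, Lz, L) ->
  exists beta g rm : R,
  [/\ [/\ -1 < beta < 1, 0 < m, 0 < L & 0 < E < m],
      Lz = beta * L + a * E, Lz != 0, r_plus M a < g < rm &
      [/\ 0 <= radP a E beta L g, radR M a m E beta L g < 0
        & 0 < radR M a m E beta L rm]].
Proof.
move=> [beta [/andP[be0 be1] m0 Lms /andP[Emin]]].
rewrite lt_min => /andP[Em Emax] [LzE Lz0].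
move: al01 => /andP[a0 a1].
have Mm : 0 < M * m by rewrite mulr_gt0.
set l := L / (M * m); have ll : lambda_ms al beta < l.
  by rewrite ltr_pdivlMr// mulrC.
have [[xM1 xM2] xMl] := x_maxP a0 a1 be0 be1 ll.
have [xm1 xml] := x_minP a0 a1 be0 be1 ll.
have [xpx _] := x_phP a0 a1 be0 be1.
have xp1 := x_plus_gt1 a0 a1.
set xM := x_max _ _ _ in xM1 xM2 xMl *; set xm := x_min _ _ _ in xm1 xml *.
have xmM : xM < xm by exact: lt_trans xm1.
have xm2 : x_ph al beta < xm by exact: lt_trans xmM.
have l0 : 0 < l by rewrite -xml; exact: lambda_sph_gt0.
have [_ PM0 PM2] := sph_orbit a0 a1 be0 be1 xM1.
have [em0 Pm0 Pm2] := sph_orbit a0 a1 be0 be1 xm2.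
rewrite xMl xml in PM0 PM2 Pm0 Pm2.
have eM : E / m < eps_sph al beta xM by rewrite ltr_pdivrMr// mulrC.
have em : eps_sph al beta xm < E / m by rewrite ltr_pdivlMr// mulrC.
have e0 : 0 < E / m := lt_trans em0 em.
have E0 : 0 < E by move: e0; rewrite pmulr_lgt0 ?invr_gt0.
have xM0 : 0 < xM by lra.
have xm0 : 0 < xm by lra.
have sc : 0 < m ^+ 2 * M ^+ 4 by rewrite mulr_gt0// exprn_gt0.
have sc' : 0 < m * M ^+ 2 by rewrite mulr_gt0// exprn_gt0.
have Pm : eps_sph al beta xm * xm ^+ 2 - al * beta * l <
    E / m * xm ^+ 2 - al * beta * l.
  by rewrite ltrD2r ltr_pM2r// exprn_gt0.
(* The spherical orbit at [xm] has [radR = 0] and [radP > 0]; raising its energy to [E] increases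
   the square. *)
have Rm : 0 < radR M a m E beta L (M * xm).
  rewrite radR_scale// pmulr_rgt0// -/l -Pm2 subr_gt0 ltr_sqr// ?nnegrE ltW//.
  exact: lt_trans Pm.
have L0 : 0 < L by move: l0; rewrite pmulr_lgt0 ?invr_gt0.
suff [y [xpy yxm Py Ry]] : exists y, [/\ x_plus al < y, y < xm,
    0 <= radP a E beta L (M * y) & radR M a m E beta L (M * y) < 0].
  exists beta, (M * y), (M * xm); split => //; first by rewrite be0 be1 E0.
  by rewrite r_plus_scale !ltr_pM2l// xpy.
(* Lowering the energy at [xM] decreases the square of [radP] only as long as [radP] stays
   nonnegative. *)
have [PM|PM] := leP 0 (E / m * xM ^+ 2 - al * beta * l).
  exists xM; split => //; first exact: lt_trans xM1.
    by rewrite (radP_scale _ _ _ _ m0) mulr_ge0// ltW.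
  rewrite radR_scale// pmulr_rlt0// -/l -PM2 subr_lt0 ltr_sqr// ?nnegrE ?ltW//.
  by rewrite ltrD2r ltr_pM2r// exprn_gt0.
have kl : 0 < al * beta * l.
  have : 0 < E / m * xM ^+ 2 by rewrite mulr_gt0// exprn_gt0.
  lra.
(* The zero of [radP], which lies between [xM] and [xm] because [radP] is negative at the first and
   positive at the second. There [radR] reduces to its negative term. *)
pose y := Num.sqrt (al * beta * l / (E / m)).
have y2 : E / m * y ^+ 2 = al * beta * l.
  rewrite sqr_sqrtr; last by rewrite ltW// divr_gt0.
  by rewrite mulrC divfK// gt_eqF.
have xMy : xM < y.
  apply: ltr_of_sqr; first exact: sqrtr_ge0.
  by rewrite -(ltr_pM2l e0) y2; lra.
exists y; split.
- exact/(lt_trans _ xMy)/lt_trans/xM1.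
- by apply: ltr_of_sqr;
  [exact: ltW|rewrite -(ltr_pM2l e0) y2 -subr_gt0 (lt_trans Pm0)].
- by rewrite (radP_scale _ _ _ _ m0) -/l y2 subrr mulr0.
- rewrite radR_scale// pmulr_rlt0// -/l y2 subrr expr0n/= sub0r oppr_lt0.
  rewrite mulr_gt0//; first exact: D_gt0 (lt_trans (lt_trans xpx xM1) xMy).
  by rewrite addr_gt0// exprn_gt0//; lra.
Qed.
End KerrScaling.

Section Quartic.
Variables (R : realType) (M a m E beta L : R).
Implicit Types r : R.
Let rR := radR M a m E beta L.

(** The secant slope from [u] to [v] is positive, and by convexity the quadratic keeps rising after
    [v]. *)
Lemma quad_pos (c d e u v w : R) : 0 <= c -> u < v -> v <= w ->
  c * u ^+ 2 + d * u + e <= 0 -> 0 < c * v ^+ 2 + d * v + e ->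
  0 < c * w ^+ 2 + d * w + e.
Proof.
move=> c0 uv vw qu qv.
have sl : 0 < c * (u + v) + d.
  have : 0 < (v - u) * (c * (u + v) + d).
    rewrite (_ : _ * _ = (c * v ^+ 2 + d * v + e) - (c * u ^+ 2 + d * u + e));
      last by ring.
    lra.
  by rewrite pmulr_rgt0 ?subr_gt0.
rewrite (_ : _ + _ + _ = c * v ^+ 2 + d * v + e + (w - v) * (c * (u + v) + d
   + c * (w - u))); last by ring.
rewrite ltr_pwDl// mulr_ge0 ?subr_ge0// addr_ge0 ?(ltW sl)// mulr_ge0//
  subr_ge0.
by rewrite ltW// (lt_le_trans uv).
Qed.

Lemma quad_neg (c d e u v w : R) : 0 <= c -> u <= v -> v <= w ->
  c * u ^+ 2 + d * u + e <= 0 -> c * w ^+ 2 + d * w + e <= 0 ->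
  c * v ^+ 2 + d * v + e <= 0.
Proof.
move=> c0; rewrite le_eqVlt => /orP[/eqP->//|uv] vw qu; move=> qw.
by rewrite leNgt; apply/negP => qv; have := quad_pos c0 uv vw qu qv;
  rewrite ltNge qw.
Qed.

Lemma radR_continuous : continuous rR.
Proof.
by move=> x; rewrite /continuous_at /rR /radR /radP /horizon; cvg_tac.
Qed.

(** Division by the quadratic with roots [r1] and [r2] leaves an affine remainder, which vanishes at
    two distinct points. *)
Lemma radR_factor r1 r2 : r1 != r2 -> rR r1 = 0 -> rR r2 = 0 ->
  exists d e, forall r, rR r =
    (r - r1) * (r2 - r) * ((m ^+ 2 - E ^+ 2) * r ^+ 2 + d * r + e).
Proof.
move=> r12 R1 R2.
pose c := m ^+ 2 - E ^+ 2.
(* [A3] and [A2] are the cubic and quadratic coefficients of [radR]. The quotient is read off from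
   the top degree downwards, and [u * r + v] is the remainder. *)
pose A3 := 2 * M * m ^+ 2.
pose A2 := - 2 * E * (a * beta * L) - a ^+ 2 * m ^+ 2 - L ^+ 2.
pose d := (r1 + r2) * c - A3.
pose e := (r1 + r2) * d - r1 * r2 * c - A2.
pose u := 2 * M * L ^+ 2 - ((r1 + r2) * e - r1 * r2 * d).
pose v := (a * beta * L) ^+ 2 - a ^+ 2 * L ^+ 2 + r1 * r2 * e.
have H r : rR r = (r - r1) * (r2 - r) * (c * r ^+ 2 + d * r + e) + (u * r + v).
  by rewrite /rR /radR /radP /horizon /u /v /e /d /A2 /A3 /c; ring.
have u1 : u * r1 + v = 0 by rewrite -R1 H subrr !mul0r add0r.
have u2 : u * r2 + v = 0 by rewrite -R2 H subrr mulr0 !mul0r add0r.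
have u0 : u = 0.
  have : u * (r1 - r2) = 0 by
    rewrite mulrBr -[u * r1](addrK v) u1 -[u * r2](addrK v) u2 subrr.
  by move/eqP; rewrite mulf_eq0 [r1 - r2 == 0]subr_eq0 (negbTE r12) orbF
    => /eqP.
have v0 : v = 0 by move: u1; rewrite u0 mul0r add0r.
by exists d, e => r; rewrite H u0 v0 mul0r !addr0.
Qed.

Lemma radR_neg_far x : 0 < E < m -> exists2 w, x < w & rR w < 0.
Proof.
move=> /andP[E0 Em].
have c0 : 0 < m ^+ 2 - E ^+ 2 by rewrite subr_gt0 ltr_sqr// nnegrE ltW//
  (lt_trans E0).
pose c := m ^+ 2 - E ^+ 2.
pose A3 := 2 * M * m ^+ 2.
pose A2 := - 2 * E * (a * beta * L) - a ^+ 2 * m ^+ 2 - L ^+ 2.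
pose A1 := 2 * M * L ^+ 2.
pose A0 := (a * beta * L) ^+ 2 - a ^+ 2 * L ^+ 2.
pose S := `|A3| + `|A2| + `|A1| + `|A0|.
have S0 : 0 <= S by rewrite !addr_ge0.
have Sc0 : 0 <= S / c by rewrite divr_ge0// ltW.
(* Beyond this point [c * w] exceeds the sum [S] of the absolute values of the lower coefficients,
   and [1 <= w] lets [w ^+ 3] dominate the lower powers. *)
pose w := 1 + `|x| + S / c.
have w1 : 1 <= w by rewrite /w -addrA lerDl addr_ge0.
have Sw : S < c * w.
  rewrite mulrC -ltr_pdivrMr// /w; have := normr_ge0 x; lra.
exists w; first by rewrite /w; have := ler_norm x; lra.
have -> : rR w = - c * w ^+ 4 + (A3 * w ^+ 3 + A2 * w ^+ 2 + A1 * w + A0).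
  by rewrite /rR /radR /radP /horizon /A2 /A3 /c /A1 /A0; ring.
have w3 : 0 < w ^+ 3 by rewrite exprn_gt0//; lra.
have bnd (A : R) i : (i <= 3)%N -> A * w ^+ i <= `|A| * w ^+ 3.
  move=> i3; apply: (@le_trans _ _ (`|A| * w ^+ i)).
    by rewrite ler_wpM2r ?exprn_ge0 ?ler_norm//; lra.
  by rewrite ler_wpM2l// ler_weXn2l.
have := bnd A3 3%N isT; have := bnd A2 2%N isT.
have := bnd A1 1%N isT; have := bnd A0 0%N isT.
rewrite expr1 expr0 mulr1 => b0 b1 b2 b3.
have : S * w ^+ 3 < c * w * w ^+ 3 by rewrite ltr_pM2r.
have -> : c * w * w ^+ 3 = c * w ^+ 4 by ring.
have -> : S * w ^+ 3 = `|A3| * w ^+ 3 + `|A2| * w ^+ 3 + `|A1| * w ^+ 3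
  + `|A0| * w ^+ 3 by rewrite /S; ring.
move: b0 b1 b2 b3; clearbody A3 A2 A1 A0 c w; lra.
Qed.

Lemma radR_roots g rm : 0 < E < m -> g < rm -> rR g < 0 -> 0 < rR rm ->
  exists r1 r2, [/\ g < r1, r1 < r2, rR r1 = 0 & rR r2 = 0].
Proof.
move=> Em grm Rg Rrm; have [w rmw Rw] := radR_neg_far rm Em.
have [|||r1] := @IVT R rR g rm 0; first exact: ltW.
- exact/continuous_subspaceT/radR_continuous.
- by rewrite ge_min le_max (ltW Rg) (ltW Rrm) orbT.
rewrite in_itv/= => /andP[gr1 r1m] R1.
have [|||r2] := @IVT R rR rm w 0; first exact: ltW.
- exact/continuous_subspaceT/radR_continuous.
- by rewrite ge_min le_max (ltW Rw) (ltW Rrm) orbT.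
rewrite in_itv/= => /andP[mr2 r2w] R2.
exists r1, r2; split => //.
  by rewrite lt_neqAle gr1 andbT; apply: contraTneq Rg => ->; rewrite R1 ltxx.
apply: lt_le_trans mr2; rewrite lt_neqAle r1m andbT.
by apply: contraTneq Rrm => <-; rewrite R1 ltxx.
Qed.
End Quartic.

Section Horizons.
Variables (R : realType) (M a : R).
Hypotheses (M0 : 0 < M) (al01 : 0 <= a / M < 1).
Let rp := r_plus M a.
Let rm := r_minus M a.

Lemma a_bounds : 0 <= a < M.
Proof.
by move: al01; rewrite ltr_pdivrMr// mul1r pmulr_lge0// invr_gt0.
Qed.

Lemma horizons_gap : exists d, [/\ 0 < d, d <= M, d ^+ 2 = M ^+ 2 - a ^+ 2,
  rp = M + d & rm = M - d].
Proof.
have /andP[a0 aM] := a_bounds; move: M0 => M0'.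
have d0 : 0 < M ^+ 2 - a ^+ 2 by rewrite subr_gt0 ltr_sqr// nnegrE ltW.
exists (Num.sqrt (M ^+ 2 - a ^+ 2)); split => //.
- by rewrite sqrtr_gt0.
- rewrite -ler_sqr ?nnegrE ?sqrtr_ge0 ?(ltW M0)// sqr_sqrtr ?(ltW d0)//.
  by rewrite gerBl sqr_ge0.
- by rewrite sqr_sqrtr// ltW.
Qed.

Lemma r_minus_ge0 : 0 <= rm.
Proof. by have [d [_ dM _ _ ->]] := horizons_gap; rewrite subr_ge0. Qed.

Lemma r_minus_lt_r_plus : rm < rp.
Proof. by have [d [d0 dM _ -> ->]] := horizons_gap; lra. Qed.

Lemma r_plus_gt0 : 0 < rp.
Proof. exact: le_lt_trans r_minus_ge0 r_minus_lt_r_plus. Qed.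

Lemma horizon_factor r : horizon M a r = (r - rp) * (r - rm).
Proof.
have [d [_ _ d2 -> ->]] := horizons_gap; rewrite /horizon.
have -> : a ^+ 2 = M ^+ 2 - d ^+ 2 by rewrite d2; ring.
by ring.
Qed.

Lemma horizon_r_plus : horizon M a rp = 0.
Proof. by rewrite horizon_factor subrr mul0r. Qed.

Lemma horizon_gt0 r : rp < r -> 0 < horizon M a r.
Proof.
move=> rpr; rewrite horizon_factor mulr_gt0 ?subr_gt0//.
exact: lt_trans r_minus_lt_r_plus rpr.
Qed.

(** To the left of [r1] the signs of [G] and [radR] are opposite; at the outer horizon [radR] is a
    square, and at [g] it is negative. *)
Lemma radial_data (m E beta L g s : R) : 0 < E < m -> rp < g -> g < s ->
  radR M a m E beta L g < 0 -> 0 < radR M a m E beta L s ->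
  exists r1 r2 d e, let G r := (m ^+ 2 - E ^+ 2) * r ^+ 2 + d * r + e in
  [/\ g < r1, r1 < r2,
    forall r, radR M a m E beta L r = (r - r1) * (r2 - r) * G r,
    G rp <= 0 & 0 < G g].
Proof.
move=> Em rpg gs Rg Rs.
have [r1 [r2 [gr1 r12 R1 R2]]] := radR_roots Em gs Rg Rs.
have [|d [e RE]] := @radR_factor R M a m E beta L r1 r2 _ R1 R2.
  by rewrite lt_eqF.
exists r1, r2, d, e; split => //.
  have : 0 <= radR M a m E beta L rp.
    by rewrite /radR horizon_r_plus mul0r subr0 sqr_ge0.
  rewrite RE -mulrA => Rp; rewrite leNgt; apply/negP => Gp; move: Rp.
  rewrite leNgt nmulr_rlt0 ?subr_lt0 ?(lt_trans rpg)//.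
  by rewrite mulr_gt0// subr_gt0 (lt_trans rpg)// (lt_trans gr1).
move: Rg; rewrite RE -mulrA nmulr_rlt0 ?subr_lt0//.
by rewrite pmulr_rgt0// subr_gt0 (lt_trans gr1).
Qed.

End Horizons.

Lemma polT_factor (R : realType) (a m E beta L : R) :
  -1 < beta < 1 -> 0 < L -> 0 < E < m -> beta * L + a * E != 0 ->
  exists u0 b d, [/\ 0 < u0 < 1,
    forall u, polT a m E beta L u = (u0 - u) * (b - d * u) &
    forall u, 0 <= u <= 1 -> 0 < b - d * u].
Proof.
move=> /andP[be0 be1] L0 /andP[E0 Em] Lz0.
pose T := polT a m E beta L.
have T0 : 0 < T 0.
  have be2 : 0 < 1 - beta ^+ 2 by nra.
  rewrite (_ : T 0 = L ^+ 2 * (1 - beta ^+ 2)); last by rewrite /T /polT; ring.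
  by rewrite mulr_gt0// exprn_gt0.
have T1 : T 1 < 0.
  rewrite (_ : T 1 = - (beta * L + a * E) ^+ 2); last by rewrite /T /polT; ring.
  by rewrite oppr_lt0 exprn_even_gt0.
have [|||u0] := @IVT R T 0 1 0; first exact: ler01.
- apply: continuous_subspaceT => x.
  by rewrite /continuous_at /T /polT; cvg_tac.
- by rewrite ge_min le_max (ltW T0) (ltW T1) orbT.
rewrite in_itv/= => /andP[u0ge u0le] Tu0.
have u00 : 0 < u0.
  by rewrite lt_neqAle u0ge andbT; apply: contraTneq T0 => uE; move: Tu0;
    rewrite -uE => ->; rewrite ltxx.
have u01 : u0 < 1.
  by rewrite lt_neqAle u0le andbT; apply: contraTneq T1 => uE; move: Tu0;
    rewrite uE => ->; rewrite ltxx.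
have u0n : u0 != 0 by rewrite gt_eqF.
(* [d] is the leading coefficient of [polT], and [b * u0] is its value at 0. *)
pose d := a ^+ 2 * (m ^+ 2 - E ^+ 2).
pose b := L ^+ 2 * (1 - beta ^+ 2) / u0.
have TE u : T u = (u0 - u) * (b - d * u).
  (* Subtracting [u / u0] times [T u0 = 0] cancels the linear coefficient of [T]. *)
  rewrite -[LHS]subr0 -[X in _ - X](mul0r (u / u0)) -{1}Tu0.
  by rewrite /T /polT /b /d; field; rewrite u0n.
exists u0, b, d; split => [||u /andP[uge ule]]; [by rewrite u00|exact: TE|].
have b0 : 0 < b by move: T0; rewrite TE subr0 mulr0 subr0 pmulr_rgt0.
have b1 : 0 < b - d by move: T1; rewrite TE mulr1 nmulr_rlt0 ?subr_lt0.
rewrite (_ : _ - _ = b * (1 - u) + (b - d) * u); last by ring.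
move: u0ge uge ule b0 b1; clearbody b d; case: (eqVneq u 0) => [->|un]
  _ uge ule b0 b1.
  by rewrite subr0 mulr1 mulr0 addr0.
have u0' : 0 < u by rewrite lt_neqAle eq_sym un.
by rewrite ltr_wpDl ?mulr_gt0// mulr_ge0 ?(ltW b0)// subr_ge0.
Qed.

(* A timelike covector is future-directed with respect to [- grad t] exactly
   when it is so with respect to [(r^2 + a^2) d/dt + a d/dphi], which is
   timelike where [0 < D]; here [N = 2 M r], [A = a sin theta] and
   [B = r^2 + a^2]. *)
Lemma future_criterion (R : realType) (B N A D P w q : R) :
  0 < B -> 0 <= D -> N ^+ 2 + D * A ^+ 2 <= B ^+ 2 -> w ^+ 2 + D * q ^+ 2 < P
    ^+ 2 ->
  (0 < B * P + (N * w + D * A * q)) = (0 < P).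
Proof.
move=> B0 D0 NB wP.
(* The Cauchy-Schwarz inequality for the inner product with weights 1 and [D]. *)
have X2 : (N * w + D * A * q) ^+ 2 < (B * P) ^+ 2.
  apply: (@le_lt_trans _ _ ((N ^+ 2 + D * A ^+ 2) * (w ^+ 2 + D * q ^+ 2))).
    rewrite -subr_ge0 (_ : _ - _ = D * (N * q - A * w) ^+ 2); last by ring.
    by rewrite mulr_ge0// sqr_ge0.
  rewrite exprMn; apply: (@le_lt_trans _ _ (B ^+ 2 * (w ^+ 2 + D * q ^+ 2))).
    by rewrite ler_wpM2r// addr_ge0 ?sqr_ge0// mulr_ge0// sqr_ge0.
  by rewrite ltr_pM2l// exprn_gt0.
have BP : 0 < P = (0 < B * P) by rewrite pmulr_rgt0.
rewrite BP; move: (N * w + _) (B * P) X2 => X Y XY.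
by apply/idP/idP => h; nra.
Qed.

Section Future.
Variables (R : realType) (M a m E beta L : R).
Hypotheses (M0 : 0 < M) (al01 : 0 <= a / M < 1) (m0 : 0 < m).

Lemma future_outside (r th pr pth : R) : r_plus M a < r -> 0 < th < pi ->
  sin th ^+ 2 * pth ^+ 2 = polT a m E beta L (cos th ^+ 2) ->
  horizon M a r * pr ^+ 2 - 2 * radQ M a E beta L r * pr
    + radC M a m E beta L r = 0 ->
  (0 < 2 * M * r * pr + (rho2 a r th + 2 * M * r) * E) =
    (0 < radP a E beta L r).
Proof.
move=> rpr th0 T1 R1; have s0 := sin_gt0_pi th0.
have D0 := horizon_gt0 M0 al01 rpr;
  have r0 := lt_trans (r_plus_gt0 M0 al01) rpr.
(* On the level set [j / s] is the combination [p_ph / sin theta + a * sin theta * p_t] that is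
   squared in [F3]. *)
set j := beta * L + a * E * cos th ^+ 2; set s := sin th in s0 T1 *.
have c2 : cos th ^+ 2 = 1 - s ^+ 2 by rewrite cos2sin2.
have q2 : (j / s) ^+ 2 <= L ^+ 2.
  rewrite exprMn exprVn ler_pdivrMr ?exprn_gt0//.
  have : 0 <= polT a m E beta L (cos th ^+ 2).
    by rewrite -T1 mulr_ge0// sqr_ge0.
  rewrite /polT -/j subr_ge0 => /le_trans; apply.
  rewrite (_ : 1 - cos th ^+ 2 = s ^+ 2); last by rewrite c2; ring.
  rewrite ler_wpM2r ?sqr_ge0// gerBl.
  by rewrite -!exprMn sqr_ge0.
pose w := horizon M a r * pr - radQ M a E beta L r.
have w2 : w ^+ 2 = radR M a m E beta L r.
  rewrite radRE; transitivity (radQ M a E beta L r ^+ 2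
     - horizon M a r * radC M a m E beta L r + horizon M a r *
      (horizon M a r * pr ^+ 2 - 2 * radQ M a E beta L r * pr
    + radC M a m E beta L r)); last by rewrite R1 mulr0 addr0.
  by rewrite /w; ring.
rewrite -(@future_criterion _ (r ^+ 2 + a ^+ 2) (2 * M * r) (a * s)
  (horizon M a r) (radP a E beta L r) w (j / s)); first last.
- rewrite w2 /radR -ltrBrDr.
  rewrite ltrD2l ltrN2 ltr_pM2l//.
  by apply: le_lt_trans q2 _; rewrite ltrDr mulr_gt0// exprn_gt0.
- have s1 : s ^+ 2 <= 1 by have := sqr_ge0 (cos th); rewrite c2; lra.
  rewrite exprMn -subr_ge0.
  rewrite (_ : _ - _ = horizon M a r * (r ^+ 2 + 2 * M * r + a ^+ 2 *
    (1 - s ^+ 2))).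
    rewrite mulr_ge0 ?(ltW D0)// !addr_ge0 ?sqr_ge0//.
      by rewrite !mulr_ge0// ltW.
    by rewrite mulr_ge0 ?sqr_ge0// subr_ge0.
  by rewrite /horizon; ring.
- exact: ltW.
- by rewrite ltr_wpDr ?sqr_ge0// exprn_gt0.
(* Multiplied by the positive [horizon], the future condition is exactly the expression of
   [future_criterion]. *)
rewrite -(pmulr_rgt0 _ D0); congr (0 < _).
rewrite /w /radQ /radP /rho2 /j /horizon c2.
by field; rewrite gt_eqF.
Qed.

End Future.

(** * Topology of phase space *)

Section Topology.

Lemma path_connected_component (R : realType) (X : topologicalType) (A : set X)
    (f : R -> X) (a b : R) : a <= b -> {within `[a, b], continuous f} ->
  (forall x, a <= x <= b -> A (f x)) -> connected_component A (f a) (f b).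
Proof.
move=> ab fc fA.
have inab x : a <= x <= b -> (f @` `[a, b]) (f x).
  by move=> xab; exists x; rewrite //= in_itv.
exists (f @` `[a, b]); last by apply: inab; rewrite ab lexx.
split; first by apply: inab; rewrite ab lexx.
  by move=> _ [x + <-]; rewrite /= in_itv/= => /fA.
by apply: connected_continuous_connected => //; exact: segment_connected.
Qed.

Lemma cvg_within_continuous (X Y : topologicalType) (A : set X) (f : X -> Y) :
  (forall x, A x -> f y @[y --> x] --> f x) -> {within A, continuous f}.
Proof. by move=> fA; apply: continuous_in_subspaceT => x /set_mem /fA. Qed.

Lemma unit_circle_angle (R : realType) (u : R * R) : circle u ->
  exists s, u = (cos s, sin s).
Proof.
case: u => x y; rewrite /circle/= => xy.
have x1 : -1 <= x <= 1.
  by apply/andP; split; have := sqr_ge0 y; nra.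
have sE : sin (acos x) = `|y|.
  by rewrite sin_acos// -xy addrC addKr sqrtr_sqr.
have cE : cos (acos x) = x by rewrite acosK// in_itv.
have [y0|y0] := leP 0 y.
  by exists (acos x); rewrite cE sE ger0_norm.
by exists (- acos x); rewrite cosN sinN cE sE ltr0_norm// opprK.
Qed.

End Topology.

Section PhaseTopology.
Variable R : realType.
Implicit Types z : phase R.

Definition covector (p0 p1 p2 p3 : R) : 'rV[R]_4 :=
  p0 *: dt + p1 *: dr + p2 *: dth + p3 *: dph.

Lemma covectorE p0 p1 p2 p3 : let p := covector p0 p1 p2 p3 in
  [/\ p 0 it = p0, p 0 ir = p1, p 0 ith = p2 & p 0 iph = p3].
Proof.
by split; rewrite !mxE /= ?(mulr1, mulr0, addr0, add0r).
Qed.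

Lemma covector_eta (p : 'rV[R]_4) :
  covector (p 0 it) (p 0 ir) (p 0 ith) (p 0 iph) = p.
Proof.
have [] := covectorE (p 0 it) (p 0 ir) (p 0 ith) (p 0 iph) => pt pr pth pph.
by apply/rowP; apply: forall_ord4.
Qed.

Lemma cvg_covector (T : Type) (F : set_system T) {FF : Filter F}
    (f0 f1 f2 f3 : T -> R) (l0 l1 l2 l3 : R) :
  f0 x @[x --> F] --> l0 -> f1 x @[x --> F] --> l1 ->
  f2 x @[x --> F] --> l2 -> f3 x @[x --> F] --> l3 ->
  covector (f0 x) (f1 x) (f2 x) (f3 x) @[x --> F] --> covector l0 l1 l2 l3.
Proof.
move=> h0 h1 h2 h3; rewrite /covector.
by apply: cvgD; [apply: cvgD; [apply: cvgD|]|]; apply: cvgZr_tmp.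
Qed.

End PhaseTopology.

Section PhaseContinuity.
Variables (R : realType).

Lemma cvg_fst_pt (X Y : topologicalType) (T : Type) (F : set_system T)
    {FF : Filter F} (f : T -> X * Y) (l : X * Y) :
  f x @[x --> F] --> l -> (f x).1 @[x --> F] --> l.1.
Proof. by move=> fl; apply: (@continuous_cvg _ _ _ F FF f fst l _ fl);
  exact: cvg_fst. Qed.

Lemma cvg_snd_pt (X Y : topologicalType) (T : Type) (F : set_system T)
    {FF : Filter F} (f : T -> X * Y) (l : X * Y) :
  f x @[x --> F] --> l -> (f x).2 @[x --> F] --> l.2.
Proof. by move=> fl; apply: (@continuous_cvg _ _ _ F FF f snd l _ fl);
  exact: cvg_snd. Qed.

Lemma cvg_entry (T : Type) (F : set_system T) {FF : Filter F}
    (f : T -> 'rV[R]_4) (l : 'rV[R]_4) i :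
  f x @[x --> F] --> l -> f x 0 i @[x --> F] --> l 0 i.
Proof.
move=> fl; apply: (@continuous_cvg _ _ _ F FF f (fun p : 'rV_4
  => p 0 i) l _ fl).
exact: coord_continuous.
Qed.

Implicit Types z : phase R.

Definition time z : R := z.1.1.1.1.

Lemma cvg_time z : time y @[y --> z] --> time z.
Proof. by do 4!apply: cvg_fst_pt; exact: cvg_id. Qed.

Lemma cvg_radius z : radius y @[y --> z] --> radius z.
Proof. by apply: cvg_snd_pt; do 3!apply: cvg_fst_pt; exact: cvg_id. Qed.

Lemma cvg_theta z : theta y @[y --> z] --> theta z.
Proof. by apply: cvg_snd_pt; do 2!apply: cvg_fst_pt; exact: cvg_id. Qed.

Lemma cvg_phi_pt z : phi_pt y @[y --> z] --> phi_pt z.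
Proof. by apply: cvg_snd_pt; apply: cvg_fst_pt; exact: cvg_id. Qed.

Lemma cvg_p_r z : p_r y @[y --> z] --> p_r z.
Proof. by apply: cvg_entry; apply: cvg_snd_pt; exact: cvg_id. Qed.

Lemma cvg_p_th z : p_th y @[y --> z] --> p_th z.
Proof. by apply: cvg_entry; apply: cvg_snd_pt; exact: cvg_id. Qed.

Lemma cvg_acos (T : Type) (F : set_system T) {FF : Filter F} (f : T -> R)
  (l : R) :
  -1 < l < 1 -> f x @[x --> F] --> l -> acos (f x) @[x --> F] --> acos l.
Proof.
move=> l1 fl.
by apply: (@continuous_cvg _ _ _ F FF f acos l _ fl); exact: continuous_acos.
Qed.
End PhaseContinuity.

(** * The component outside the potential barrier *)

Section BoundOrbits.
Variables (R : realType) (M a m E beta L g r1 r2 d e u0 b0 d0 : R).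
Let G r := (m ^+ 2 - E ^+ 2) * r ^+ 2 + d * r + e.
Let q c := b0 - d0 * c ^+ 2.
Hypotheses (M0 : 0 < M) (al01 : 0 <= a / M < 1) (m0 : 0 < m) (E01 : 0 < E < m).
Hypotheses (rpg : r_plus M a < g) (gr1 : g < r1) (r12 : r1 < r2).
Hypothesis RE : forall r, radR M a m E beta L r = (r - r1) * (r2 - r) * G r.
Hypotheses (Gp : G (r_plus M a) <= 0) (Gg : 0 < G g)
  (Pg : 0 <= radP a E beta L g).
Hypothesis u01 : 0 < u0 < 1.
Hypothesis TE : forall u, polT a m E beta L u = (u0 - u) * (b0 - d0 * u).
Hypothesis Tpos : forall u, 0 <= u <= 1 -> 0 < b0 - d0 * u.
Let Lz := beta * L + a * E.
Let A := Gamma_level M a m E Lz L.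
Let hz := horizon M a.
Let rQ := radQ M a E beta L.
Let mid := (r1 + r2) / 2.
Let half := (r2 - r1) / 2.
Implicit Types (r th c : R) (z : phase R) (y : R * (R * R) * (R * R) * (R * R)).

Let c_ge0 : 0 <= m ^+ 2 - E ^+ 2.
Proof.
move: m0 E01 => m0' /andP[E0 Em].
by rewrite subr_ge0 ler_sqr ?nnegrE ltW.
Qed.

Let G_gt0 r : g <= r -> 0 < G r.
Proof. by move=> gr; exact: quad_pos c_ge0 rpg gr Gp Gg. Qed.

Let rp_gt0 : 0 < r_plus M a. Proof. exact: r_plus_gt0. Qed.

Lemma radP_mono r r' : 0 <= r -> r <= r' -> radP a E beta L r <= radP a E beta
  L r'.
Proof.
move=> r0 rr; have /andP[E0 _] := E01.
by rewrite lerD2r ler_pM2l// ler_sqr ?nnegrE// (le_trans r0).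
Qed.

Let P_gt0 r : g < r -> 0 < radP a E beta L r.
Proof.
move=> gr; apply: le_lt_trans Pg _; have /andP[E0 _] := E01.
have g0 := lt_trans rp_gt0 rpg.
by rewrite ltrD2r ltr_pM2l// ltr_sqr ?nnegrE ?ltW// (lt_trans g0).
Qed.

Let half_gt0 : 0 < half.
Proof. by rewrite divr_gt0// subr_gt0. Qed.

(** Outside the horizon the radial equation may be multiplied by [hz], which completes the square,
    and [future_outside] turns the future condition into positivity of [radP]. *)
Lemma level_outside z : r_plus M a < radius z -> A z <->
  [/\ 0 < theta z < pi, circle (phi_pt z), p_t z = - E /\ p_ph z = Lz,
      sin (theta z) ^+ 2 * p_th z ^+ 2 = polT a m E beta L (cos
        (theta z) ^+ 2) &
      (hz (radius z) * p_r z - rQ (radius z)) ^+ 2 = radR M a m E beta L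
        (radius z)
      /\ 0 < radP a E beta L (radius z)].
Proof.
move=> rpr; have rmr := lt_trans (r_minus_lt_r_plus M0 al01) rpr.
have hz0 : hz (radius z) != 0 by rewrite gt_eqF// horizon_gt0.
have wE : (hz (radius z) * p_r z - rQ (radius z)) ^+ 2 - radR M a m E beta L
  (radius z)
    = hz (radius z) * (hz (radius z) * p_r z ^+ 2 - 2 * rQ (radius z) * p_r z
          + radC M a m E beta L (radius z)).
  by rewrite radRE /rQ /hz; ring.
split.
  move=> /(Gamma_levelP E beta L z m0
    (r_minus_ge0 M0 al01))[_ th0 cu p1 [T1 R1 fut]].
  split => //; split.
    by apply/eqP; rewrite -subr_eq0 wE R1 mulr0.
  by rewrite -(future_outside M0 al01 m0 rpr th0 T1 R1).
move=> [th0 cu p1 T1 [w2 P0]].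
have R1 : hz (radius z) * p_r z ^+ 2 - 2 * rQ (radius z) * p_r z
    + radC M a m E beta L (radius z) = 0.
  by apply: (mulfI hz0); rewrite -wE w2 subrr mulr0.
apply/(Gamma_levelP E beta L z m0 (r_minus_ge0 M0 al01)).
by split => //; split => //; rewrite (future_outside M0 al01 m0 rpr th0 T1 R1).
Qed.

(** On the level set [radR] is a square, but it is negative at [g]. *)
Lemma level_gap z : A z -> radius z != g.
Proof.
move=> Az; apply/eqP => zg.
have [|/(_ Az)[_ _ _ _ [w2 _]] _] := @level_outside z; first by rewrite zg.
have : 0 <= radR M a m E beta L g by rewrite -zg -w2 sqr_ge0.
rewrite RE leNgt -mulrA nmulr_rlt0 ?subr_lt0// mulr_gt0// subr_gt0.
exact: lt_trans r12.
Qed.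

(* With [half] and [mid] the half-length and midpoint of [[r1, r2]], the radial
   equation reads
     [(r - mid)^2 + (horizon r * p_r - radQ r)^2 / G r = half^2]
   and the polar one
     [cos^2 theta + (sin theta * p_theta)^2 / q (cos theta) = u0]. *)
Definition chart z : R * (R * R) * (R * R) * (R * R) :=
  let r := radius z in let c := cos (theta z) in
  (time z, phi_pt z,
   ((r - mid) / half, (hz r * p_r z - rQ r) / (half * Num.sqrt (G r))),
   (c / Num.sqrt u0, sin (theta z) * p_th z / (Num.sqrt u0 * Num.sqrt (q c)))).

Definition unchart y : phase R :=
  let r := mid + half * y.1.2.1 in let c := Num.sqrt u0 * y.2.1 in
  (y.1.1.1, r, acos c, y.1.1.2,
   covector (- E) ((rQ r + half * y.1.2.2 * Num.sqrt (G r)) / hz r)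
     (Num.sqrt u0 * y.2.2 * Num.sqrt (q c) / sin (acos c)) Lz).

Let sqrt_u0 : 0 < Num.sqrt u0. Proof. by rewrite sqrtr_gt0; case/andP: u01. Qed.

Let sqrt_u0_sqr : Num.sqrt u0 ^+ 2 = u0.
Proof. by rewrite sqr_sqrtr// ltW//; case/andP: u01. Qed.

Let q_gt0 c : c ^+ 2 <= 1 -> 0 < q c.
Proof. by move=> c1; apply: Tpos; rewrite sqr_ge0. Qed.

Let cos_sqr_le1 th : cos th ^+ 2 <= 1.
Proof. by rewrite cos2sin2 gerBl sqr_ge0. Qed.

Lemma chart_torus z : A z -> g < radius z -> R_times_T3 (chart z).
Proof.
move=> Az gz; have [/(_ Az)[th0 cu _ T1 [w2 _]] _]
  := level_outside (lt_trans rpg gz).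
have Gz := G_gt0 (ltW gz).
have qz := q_gt0 (cos_sqr_le1 (theta z)).
have sqV (x y b : R) : 0 <= b -> (x / (y * Num.sqrt b)) ^+ 2 = x ^+ 2 /
  (y ^+ 2 * b).
  by move=> b_ge0; rewrite exprMn exprVn exprMn sqr_sqrtr.
split; [split; [split => //|]|]; rewrite /circle /= sqV ?ltW//.
  rewrite w2 RE.
  by rewrite /mid /half; field; rewrite !gt_eqF ?subr_gt0.
rewrite !exprMn exprVn sqrt_u0_sqr T1 TE.
rewrite /q in qz *; move: (b0 - _) qz => b b_gt0.
by case/andP: u01 => u00 _; field; rewrite !gt_eqF.
Qed.

Lemma unchart_radius y : R_times_T3 y -> r1 <= radius (unchart y) <= r2.
Proof.
case: y => [[[t u] [X Y]] W] [[_ /= XY] _]; rewrite /circle /= in XY.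
have X1 : -1 <= X <= 1 by apply/andP; split; have := sqr_ge0 Y; nra.
rewrite /unchart /Defs.radius /= (_ : r1 = mid - half);
  last by rewrite /mid /half; field.
rewrite (_ : r2 = mid + half); last by rewrite /mid /half; field.
have := half_gt0; case/andP: X1 => X1 X2; move: half mid => hf md hf0.
by apply/andP; split; nra.
Qed.

Lemma unchart_cos_lt1 y : R_times_T3 y -> -1 < Num.sqrt u0 * y.2.1 < 1.
Proof.
case: y => [[v w] [W V]] [_ /=]; rewrite /circle /= => WV.
have : (Num.sqrt u0 * W) ^+ 2 < 1.
  rewrite exprMn sqrt_u0_sqr; move: u01 => /andP[u00 u1].
  have := sqr_ge0 V; nra.
by move: (Num.sqrt u0 * W) => c c1; apply/andP; split; nra.
Qed.

Lemma unchart_level y : R_times_T3 y -> A (unchart y) /\ g < radius (unchart y).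
Proof.
move=> By; have /andP[ur1 ur2] := unchart_radius By.
have gu : g < radius (unchart y) by exact: lt_le_trans ur1.
split => //; apply/(level_outside (lt_trans rpg gu)).
have := unchart_cos_lt1 By => /andP[c1 c2].
have Gz := G_gt0 (ltW gu).
have hz0 : hz (radius (unchart y)) != 0 by rewrite gt_eqF// horizon_gt0//
  (lt_trans rpg).
have th0 : 0 < acos (Num.sqrt u0 * y.2.1) < pi.
  by rewrite acos_gt0 ?acos_ltpi// ?c1 ?c2 ?andbT// ltW.
have cE : cos (acos (Num.sqrt u0 * y.2.1)) = Num.sqrt u0 * y.2.1.
  by rewrite acosK// in_itv/= !ltW.
have qz := q_gt0 (cos_sqr_le1 (acos (Num.sqrt u0 * y.2.1))); rewrite cE in qz.
have s0 := sin_gt0_pi th0.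
case: y By c1 c2 Gz gu ur1 ur2 hz0 th0 cE qz s0 => [[[t u] [X Y]] [W V]] /=.
move=> [[[_ cu] /= XY] /= WV]; rewrite /circle /= in cu XY WV.
rewrite /theta /phi_pt /p_t /p_ph /p_th /p_r /Defs.radius /momentum /=.
set r := mid + half * X; set c := Num.sqrt u0 * W.
move=> c1 c2 Gz gu ur1 ur2 hz0 th0 cE qz s0.
have [-> -> -> ->] := covectorE (- E) ((rQ r + half * Y * Num.sqrt
  (G r)) / hz r)
     (Num.sqrt u0 * V * Num.sqrt (q c) / sin (acos c)) Lz.
split => //.
  rewrite cE TE -exprMn mulrC divfK ?gt_eqF//.
  rewrite !exprMn sqrt_u0_sqr sqr_sqrtr ?(ltW qz)//.
  have -> : V ^+ 2 = 1 - W ^+ 2 by rewrite -WV; ring.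
  by rewrite /q /c exprMn sqrt_u0_sqr; ring.
split; last exact: P_gt0.
rewrite mulrC divfK// addrC addKr RE !exprMn sqr_sqrtr ?(ltW Gz)//.
have -> : Y ^+ 2 = 1 - X ^+ 2 by rewrite -XY; ring.
by rewrite /r /mid /half; field.
Qed.

Lemma chartK z : A z -> g < radius z -> unchart (chart z) = z.
Proof.
move=> Az gz; have [/(_ Az)[th0 cu [ptE phE] T1 [w2 _]] _]
  := level_outside (lt_trans rpg gz).
have Gz := G_gt0 (ltW gz).
have qz := q_gt0 (cos_sqr_le1 (theta z)).
have hz0 : hz (radius z) != 0 by rewrite gt_eqF// horizon_gt0// (lt_trans rpg).
have s0 := sin_gt0_pi th0.
have rE : mid + half * ((radius z - mid) / half) = radius z.
  by rewrite mulrC divfK ?gt_eqF// addrC subrK.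
have cE : Num.sqrt u0 * (cos (theta z) / Num.sqrt u0) = cos (theta z).
  by rewrite mulrC divfK ?gt_eqF.
have thE : acos (cos (theta z)) = theta z.
  by rewrite cosK// in_itv/= !ltW; case/andP: th0.
rewrite /unchart /chart /= rE cE thE.
have -> : covector (- E) ((rQ (radius z) + half *
    ((hz (radius z) * p_r z - rQ (radius z)) / (half * Num.sqrt (G (radius z))))
    * Num.sqrt (G (radius z))) / hz (radius z))
    (Num.sqrt u0 * (sin (theta z) * p_th z / (Num.sqrt u0 * Num.sqrt (q (cos
      (theta z)))))
     * Num.sqrt (q (cos (theta z))) / sin (theta z)) Lz = momentum z.
  rewrite -[RHS]covector_eta; congr covector => //;
    rewrite -/(p_r z) -/(p_th z).
    by field; rewrite hz0 !gt_eqF// sqrtr_gt0.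
  by field; rewrite !gt_eqF// sqrtr_gt0.
by case: z {Az gz th0 cu ptE phE T1 w2 Gz qz hz0 s0 rE cE thE} => [[[[? ?] ?]
  ?] ?].
Qed.

Lemma unchartK y : R_times_T3 y -> chart (unchart y) = y.
Proof.
move=> By; have [_ gu] := unchart_level By.
have := unchart_cos_lt1 By => /andP[c1 c2].
have Gz := G_gt0 (ltW gu).
have hz0 : hz (radius (unchart y)) != 0 by rewrite gt_eqF// horizon_gt0//
  (lt_trans rpg).
have th0 : 0 < acos (Num.sqrt u0 * y.2.1) < pi.
  by rewrite acos_gt0 ?acos_ltpi// ?c1 ?c2 ?andbT// ltW.
have cE : cos (acos (Num.sqrt u0 * y.2.1)) = Num.sqrt u0 * y.2.1.
  by rewrite acosK// in_itv/= !ltW.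
have qz := q_gt0 (cos_sqr_le1 (acos (Num.sqrt u0 * y.2.1))).
have s0 := sin_gt0_pi th0.
case: y {By} c1 c2 Gz gu hz0 th0 cE qz s0 => [[[t u] [X Y]] [W V]] /=.
rewrite /chart /unchart /time /theta /phi_pt /p_th /p_r /Defs.radius /momentum
  /=.
set r := mid + half * X; set c := Num.sqrt u0 * W.
move=> c1 c2 Gz gu hz0 th0 cE qz s0.
have [_ -> -> _] := covectorE (- E) ((rQ r + half * Y * Num.sqrt (G r)) / hz r)
     (Num.sqrt u0 * V * Num.sqrt (q c) / sin (acos c)) Lz.
rewrite cE in qz *; congr (_, _, (_, _), (_, _)).
- by rewrite /r addrC addKr mulrC mulKf ?gt_eqF.
- by field; rewrite hz0 !gt_eqF// sqrtr_gt0.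
- by rewrite /c mulrC mulKf ?gt_eqF.
- by field; rewrite !gt_eqF// sqrtr_gt0.
Qed.

Let cvg_half_chart (T : Type) (F : set_system T) {FF : Filter F}
  (f : T -> R) r :
  f x @[x --> F] --> r ->
  [/\ G (f x) @[x --> F] --> G r, hz (f x) @[x --> F] --> hz r,
   rQ (f x) @[x --> F] --> rQ r & q (f x) @[x --> F] --> q r].
Proof.
by move=> fr; split; rewrite /G /q /hz /rQ /horizon /radQ; cvg_tac.
Qed.

Lemma chart_continuous z : A z -> g < radius z -> chart y @[y --> z]
  --> chart z.
Proof.
move=> Az gz; have Gz := G_gt0 (ltW gz).
have qz := q_gt0 (cos_sqr_le1 (theta z)).
have [cG chz cQ _] := cvg_half_chart (@cvg_radius _ z).
have [_ _ _ cq] := cvg_half_chart (cvg_cos (@cvg_theta _ z)).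
rewrite /chart; cvg_tac => //.
- exact: cvg_time.
- exact: cvg_phi_pt.
- exact: cvg_radius.
- exact: cvg_p_r.
- by apply: lt0r_neq0; apply: mulr_gt0 => //; rewrite sqrtr_gt0.
- exact: cvg_theta.
- exact: cvg_theta.
- exact: cvg_p_th.
- by apply: lt0r_neq0; apply: mulr_gt0 => //; rewrite sqrtr_gt0.
Qed.

Lemma unchart_continuous y : R_times_T3 y -> unchart y' @[y' --> y]
  --> unchart y.
Proof.
move=> By; have [_ gu] := unchart_level By.
have hz0 : hz (radius (unchart y)) != 0 by rewrite gt_eqF// horizon_gt0//
  (lt_trans rpg).
have /andP[c1 c2] := unchart_cos_lt1 By.
have th0 : 0 < acos (Num.sqrt u0 * y.2.1) < pi.
  by rewrite acos_gt0 ?acos_ltpi// ?c1 ?c2 ?andbT// ltW.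
have s0 := sin_gt0_pi th0.
have cr : mid + half * y'.1.2.1 @[y' --> y] --> radius (unchart y).
  apply: cvgD; first exact: cvg_cst.
  apply: cvgM; first exact: cvg_cst.
  by apply: cvg_fst_pt; apply: cvg_snd_pt; apply: cvg_fst_pt; exact: cvg_id.
have cc : Num.sqrt u0 * y'.2.1 @[y' --> y] --> Num.sqrt u0 * y.2.1.
  apply: cvgM; first exact: cvg_cst.
  by apply: cvg_fst_pt; apply: cvg_snd_pt; exact: cvg_id.
have [cG chz cQ _] := cvg_half_chart cr.
have [_ _ _ cq] := cvg_half_chart cc.
have cac : acos (Num.sqrt u0 * y'.2.1) @[y' --> y]
  --> acos (Num.sqrt u0 * y.2.1).
  by apply: cvg_acos => //; rewrite c1.
rewrite /unchart; apply: cvg_pair_pt.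
  apply: cvg_pair_pt; last by apply: cvg_snd_pt; do 2!apply: cvg_fst_pt;
    exact: cvg_id.
  apply: cvg_pair_pt => //; apply: cvg_pair_pt => //.
  by do 3!apply: cvg_fst_pt; exact: cvg_id.
apply: cvg_covector; [exact: cvg_cst| | |exact: cvg_cst].
  cvg_tac => //.
  by apply: cvg_snd_pt; apply: cvg_snd_pt; apply: cvg_fst_pt; exact: cvg_id.
cvg_tac => //; last by rewrite gt_eqF.
by do 2!apply: cvg_snd_pt; exact: cvg_id.
Qed.

Definition base_point : phase R := unchart (0, (1, 0), (1, 0), (1, 0)).

Let torus0 : @R_times_T3 R (0, (1, 0), (1, 0), (1, 0)).
Proof. by split; [split; [split|]|];
  rewrite /circle/= ?expr1n ?expr0n/= ?addr0. Qed.

Lemma base_point_level : A base_point /\ g < radius base_point.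
Proof. exact: unchart_level. Qed.

Lemma component_sub z : A z -> g < radius z -> connected_component A base_point
  z.
Proof.
move=> Az gz; rewrite -(chartK Az gz).
case: (chart z) (chart_torus Az gz) => [[[t u] v] w] [[[_ /= cu] /= cv] /= cw].
have [[a1 ->] [a2 ->] [a3 ->]] := And3 (unit_circle_angle cu)
  (unit_circle_angle cv) (unit_circle_angle cw).
(* Scaling the time and the three angles by [s] from 0 to 1 joins the base point to the given point
   inside the torus. *)
pose gam (s : R) : R * (R * R) * (R * R) * (R * R) :=
  (s * t, (cos (s * a1), sin (s * a1)), (cos (s * a2), sin (s * a2)),
   (cos (s * a3), sin (s * a3))).
have gamT s : R_times_T3 (gam s).
  by split; [split; [split|]|]; rewrite /circle/= ?cos2Dsin2.
have -> : base_point = unchart (gam 0) by rewrite /gam !mul0r cos0 sin0.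
rewrite -[t]mul1r -[a1]mul1r -[a2]mul1r -[a3]mul1r -/(gam 1).
apply: (@path_connected_component R (phase R) A (fun s => unchart (gam s)))
  => //.
  apply: cvg_within_continuous => s _.
  apply: (@continuous_cvg _ _ _ (nbhs s) _ gam unchart (gam s)).
    exact: unchart_continuous.
  by rewrite /gam; cvg_tac.
by move=> s _; have [] := unchart_level (gamT s).
Qed.

(** The radii of a connected subset form an interval, which cannot contain [g] by [level_gap]. *)
Lemma component_outside z z' : g < radius z -> connected_component A z z' ->
  g < radius z'.
Proof.
move=> gz [D [Dz DA Dc] Dz']; rewrite ltNge; apply/negP => zg.
have : connected (radius @` D).
  apply: connected_continuous_connected => //.
  by apply: cvg_within_continuous => w _; exact: cvg_radius.
move=> /connected_intervalP/(_ (radius z') (radius z)).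
move=> /(_ (ex_intro2 _ _ z' Dz' erefl) (ex_intro2 _ _ z Dz erefl) g).
rewrite zg ltW// => /(_ isT)[w Dw wg].
by have := level_gap (DA _ Dw); rewrite wg eqxx.
Qed.

Lemma base_component : connected_component A base_point = A `&` [set z | g <
  radius z].
Proof.
have [Ab gb] := base_point_level.
apply/seteqP; split => z; last by move=> [Az gz]; exact: component_sub.
by move=> bz; split;
  [exact: connected_component_sub bz|exact: component_outside bz].
Qed.

Lemma base_component_torus :
  homeomorphic (connected_component A base_point) (@R_times_T3 R).
Proof.
rewrite base_component; exists chart, unchart; split.
- split; apply: cvg_within_continuous; last exact: unchart_continuous.
  by move=> z [Az gz]; exact: chart_continuous.
- by move=> z [Az gz]; exact: chart_torus.
- by move=> y By; exact: unchart_level.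
- by move=> z [Az gz]; exact: chartK.
- by move=> y By; exact: unchartK.
Qed.

End BoundOrbits.

(** * Orbits inside the potential barrier *)

Section HorizonReaching.
Variables (R : realType) (M a m E beta L g r1 r2 d e : R).
Let G r := (m ^+ 2 - E ^+ 2) * r ^+ 2 + d * r + e.
Hypotheses (M0 : 0 < M) (al01 : 0 <= a / M < 1) (m0 : 0 < m) (E01 : 0 < E < m).
Hypotheses (gr1 : g < r1) (r12 : r1 < r2).
Hypothesis RE : forall r, radR M a m E beta L r = (r - r1) * (r2 - r) * G r.
Hypotheses (Gp : G (r_plus M a) <= 0) (Gg : 0 < G g).
Let Lz := beta * L + a * E.
Let A := Gamma_level M a m E Lz L.
Let hz := horizon M a.
Let rQ := radQ M a E beta L.
Let rC := radC M a m E beta L.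
Let rR := radR M a m E beta L.
Let rP := radP a E beta L.
Let rp := r_plus M a.
Implicit Types (r : R) (z : phase R).

Let E0 : 0 < E. Proof. by case/andP: E01. Qed.

Let rp0 : 0 < rp. Proof. exact: r_plus_gt0. Qed.

Let S_gt0 r : rp <= r -> 0 < m ^+ 2 * r ^+ 2 + L ^+ 2.
Proof.
move=> rpr; rewrite ltr_wpDr ?sqr_ge0// mulr_gt0 ?exprn_gt0//.
exact: lt_le_trans rpr.
Qed.

Let c_ge0 : 0 <= m ^+ 2 - E ^+ 2.
Proof. by rewrite subr_ge0 ler_sqr ?nnegrE ltW//; case/andP: E01. Qed.

Let R_ge0 r : r <= g -> G r <= 0 -> 0 <= rR r.
Proof.
move=> rg Gr; rewrite /rR RE; apply: mulr_le0 => //.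
have rr1 := le_lt_trans rg gr1.
by rewrite mulr_le0_ge0 ?subr_le0 ?subr_ge0 ?(ltW rr1)// ltW// (lt_trans rr1).
Qed.

(* If [radP] vanished at the horizon, [radR] would be negative just outside it,
   where [radP ^+ 2] is quadratic but [horizon] is linear in [r - r_+]. *)
Lemma radP_horizon_gt0 s : rp < s -> 0 < rP s ->
  (forall r, rp <= r <= s -> 0 <= rR r) -> 0 < rP rp.
Proof.
move=> rps Ps Rs; rewrite ltNge; apply/negP => Pp.
have cP : continuous rP by move=> x; rewrite /continuous_at /rP /radP; cvg_tac.
(* A zero of [radP] beyond the horizon would make [radR] negative there, so it can only be [rp]. *)
have [|||y] := @IVT R rP rp s 0; first exact: ltW.
- exact: continuous_subspaceT.
- by rewrite ge_min le_max Pp (ltW Ps) orbT.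
rewrite in_itv/= => ys Py; have /andP[rpy _] := ys.
have ypE : y = rp.
  have := Rs _ ys; rewrite /rR /radR -/(rP y) Py expr0n/= sub0r oppr_ge0.
  rewrite pmulr_lle0 ?S_gt0// leNgt => hy.
  by apply/eqP; rewrite eq_le rpy andbT leNgt; apply: contra hy;
    exact: horizon_gt0.
rewrite {}ypE in Py.
have rmp := r_minus_lt_r_plus M0 al01; have rm0 := r_minus_ge0 M0 al01.
(* For the [t] chosen below, [radR (rp + t)] is at most [t * (t * K - k)], and [t * K < k] makes
   this negative. *)
pose k := (rp - r_minus M a) * (m ^+ 2 * rp ^+ 2).
have k0 : 0 < k by rewrite mulr_gt0 ?subr_gt0// mulr_gt0 ?exprn_gt0.
have s0 : 0 < s := lt_trans rp0 rps.
pose K := E ^+ 2 * (2 * s) ^+ 2.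
have K0 : 0 < K by rewrite mulr_gt0 ?exprn_gt0// mulr_gt0.
pose t := Num.min (s - rp) (k / (2 * K)).
have t0 : 0 < t by rewrite lt_min subr_gt0 rps divr_gt0// mulr_gt0.
have ts : t <= s - rp by rewrite ge_min lexx.
have tK : t * K < k.
  have : t * (2 * K) <= k by rewrite -ler_pdivlMr ?mulr_gt0// ge_min lexx orbT.
  by rewrite mulrCA => tk; have := mulr_gt0 t0 K0; lra.
have /Rs : rp <= rp + t <= s.
  by rewrite lerDl (ltW t0)/=; lra.
rewrite leNgt => /negP; apply.
have -> : rR (rp + t) = t * (t * (E ^+ 2 * (2 * rp + t) ^+ 2)
   - (rp + t - r_minus M a) * (m ^+ 2 * (rp + t) ^+ 2 + L ^+ 2)).
  have aE : a * beta * L = E * rp ^+ 2.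
    by apply/eqP; rewrite eq_sym -subr_eq0; apply/eqP.
  by rewrite /rR /radR /radP (horizon_factor M0 al01) -/rp aE; ring.
rewrite pmulr_rlt0// subr_lt0; apply: (@le_lt_trans _ _ (t * K)).
  rewrite ler_pM2l// ler_pM2l ?exprn_gt0//.
  by rewrite ler_sqr ?nnegrE; move: rp0 => rp0'; lra.
apply: (lt_le_trans tK); rewrite /k.
apply: ler_pM; [by rewrite subr_ge0 ltW| |by rewrite lerD2r lerDl ltW|].
  by rewrite mulr_ge0// ?sqr_ge0.
apply: (@le_trans _ _ (m ^+ 2 * (rp + t) ^+ 2)); last by rewrite lerDl sqr_ge0.
by rewrite ler_pM2l ?exprn_gt0// ler_sqr ?nnegrE ?lerDl ?ltW// addr_gt0.
Qed.

Lemma level_reaches_horizon z : A z -> rp < radius z -> radius z < g ->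
  exists2 z', connected_component A z z' & radius z' = rp.
Proof.
move=> Az rpz zg.
have [/(_ Az)[th0 cu [ptE phE] T1 [w2 Pz]] _]
  := @level_outside R M a m E beta L M0 al01 m0 z rpz.
set s := radius z in rpz zg w2 Pz.
have Gs : G s <= 0.
  have : 0 <= rR s by rewrite /rR -w2 sqr_ge0.
  rewrite /rR RE -mulrA leNgt => Rs; rewrite leNgt; apply: contra Rs => Gs.
  have sr1 := lt_trans zg gr1.
  by rewrite nmulr_rlt0 ?subr_lt0// mulr_gt0// subr_gt0 (lt_trans sr1).
(* [r0] is the turning point of the arc. By convexity [G] is nonpositive from the horizon up to
   it. *)
have [|||r0] := @IVT R G s g 0; first exact: ltW.
- apply: continuous_subspaceT => x; rewrite /continuous_at /G; cvg_tac.
- by rewrite ge_min le_max Gs (ltW Gg) orbT.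
rewrite in_itv/= => /andP[sr0 r0g] Gr0.
have Rge0 r : rp <= r <= r0 -> 0 <= rR r.
  move=> /andP[rpr rr0]; apply: R_ge0; first exact: le_trans r0g.
  by apply: (quad_neg c_ge0 rpr rr0 Gp); rewrite -/(G r0) Gr0.
have Pp : 0 < rP rp.
  apply: (@radP_horizon_gt0 s) => // r /andP[rpr rs]; apply: Rge0.
  by rewrite rpr (le_trans rs).
have P_gt0 r : rp <= r -> 0 < rP r.
  move=> rpr; apply: (lt_le_trans Pp).
  exact: (radP_mono a beta L E01 (ltW rp0)).
(* [radQ] agrees with [radP] at the horizon, where [horizon] vanishes, and it increases with [r]. *)
have Q_gt0 r : rp <= r -> 0 < rQ r.
  move=> rpr; apply: (@lt_le_trans _ _ (rQ rp)).
    by move: Pp; rewrite /rP (radPE M) horizon_r_plus// mulr0 addr0.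
  by rewrite /rQ /radQ lerD2r ler_pM2r// ler_pM2l// mulr_gt0.
have QR_gt0 r : rp <= r -> 0 < rQ r + Num.sqrt (rR r).
  by move=> rpr; rewrite ltr_pwDl ?Q_gt0// sqrtr_ge0.
set v := p_th z in T1 *.
(* Only [r] and [p_r] move; the polar equation and the other coordinates of [z] are kept. *)
pose lift r p : phase R := (time z, r, theta z, phi_pt z, covector
  (- E) p v Lz).
have lift_level r p : rp < r -> (hz r * p - rQ r) ^+ 2 = rR r -> A (lift r p).
  move=> rpr Rr; apply/(@level_outside R M a m E beta L M0 al01 m0) => //.
  have [pt pr pth pph] := covectorE (- E) p v Lz.
  rewrite /lift /theta /phi_pt /p_t /p_ph /p_th /p_r /Defs.radius /momentum /=.
  by rewrite pt pr pth pph; split => //; split => //; apply: P_gt0; exact: ltW.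
have sE p : p_r z = p -> z = lift s p.
  move=> <-; have := covector_eta (momentum z).
  rewrite -/(p_t z) -/(p_r z) -/(p_th z) -/(p_ph z) ptE phE /lift => ->.
  by rewrite /s; case: (z) => [[[[? ?] ?] ?] ?].
(* The two roots of the radial equation. The smaller one is written with [horizon] cancelled, by
   [radQ ^+ 2 - radR = horizon * radC], so that it stays regular at [rp]. *)
pose pminus r := rC r / (rQ r + Num.sqrt (rR r)).
pose pplus r := (rQ r + Num.sqrt (rR r)) / hz r.
have pminusE r : rp <= r <= r0 -> hz r * pminus r - rQ r = - Num.sqrt (rR r).
  move=> rr; have /andP[rpr _] := rr.
  have Rr : Num.sqrt (rR r) ^+ 2 = rR r by rewrite sqr_sqrtr// Rge0.
  have QR := QR_gt0 r rpr.
  apply: (mulIf (lt0r_neq0 QR)); rewrite mulrBl -mulrA /pminus divfK ?gt_eqF//.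
  have -> : hz r * rC r = rQ r ^+ 2 - Num.sqrt (rR r) ^+ 2.
    by rewrite Rr /rR radRE opprB addrCA subrr addr0.
  by ring.
have pplusE r : rp < r -> hz r * pplus r - rQ r = Num.sqrt (rR r).
  by move=> rpr; rewrite mulrC divfK ?gt_eqF ?horizon_gt0// addrC addKr.
have cvgR r : rR x @[x --> r] --> rR r by exact: radR_continuous.
have cvgQ r : rQ x @[x --> r] --> rQ r by rewrite /rQ /radQ; cvg_tac.
have cvgC r : rC x @[x --> r] --> rC r by rewrite /rC /radC; cvg_tac.
have cvgH r : hz x @[x --> r] --> hz r by rewrite /hz /horizon; cvg_tac.
have cvg_lift (p : R -> R) r : p x @[x --> r] --> p r ->
    lift x (p x) @[x --> r] --> lift r (p r).
  move=> pr; apply: cvg_pair_pt.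
    by cvg_tac.
  by apply: cvg_covector => //; exact: cvg_cst.
have minus_level r : rp <= r <= r0 -> A (lift r (pminus r)).
  rewrite le_eqVlt => /andP[/orP[/eqP <- _|rpr rr0]]; last first.
    apply: lift_level => //; rewrite pminusE ?(ltW rpr)// sqrrN sqr_sqrtr//.
    by rewrite Rge0// (ltW rpr).
  (* At the horizon the radial equation degenerates to [radC = 2 * radQ * p_r], and membership is
     checked directly from [Gamma_levelP]. *)
  have hp := horizon_r_plus M0 al01; have Qp := Q_gt0 rp (lexx rp).
  have pE : pminus rp = rC rp / (2 * rQ rp).
    rewrite /pminus /rR radRE hp mul0r subr0 sqrtr_sqr gtr0_norm//.
    by rewrite [2 * _]mulr_natl mulr2n.
  apply/(Gamma_levelP E beta L _ m0 (r_minus_ge0 M0 al01)).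
  have [pt pr pth pph] := covectorE (- E) (pminus rp) v Lz.
  rewrite /lift /theta /phi_pt /p_t /p_ph /p_th /p_r /Defs.radius /momentum /=.
  rewrite pt pr pth pph; split => //; first exact: r_minus_lt_r_plus.
  split => //; first by rewrite hp pE -/(rQ rp) -/(rC rp); field;
    rewrite gt_eqF.
  have rho0 := rho2_gt0 a (theta z) rp0.
  (* Multiplying by [2 * radQ > 0] and using [rp ^+ 2 + a ^+ 2 = 2 * M * rp] turns the future
     condition into a sum of positive terms. *)
  rewrite -(pmulr_rgt0 _ (mulr_gt0 (ltr0Sn R 1) Qp)).
  have -> : 2 * rQ rp * (2 * M * rp * pminus rp
      + (rho2 a rp (theta z) + 2 * M * rp) * E) =
    2 * M * rp * (m ^+ 2 * rp ^+ 2 + L ^+ 2) + 2 * rQ rp * rho2 a rp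
      (theta z) * E.
    transitivity (2 * M * rp * (2 * rQ rp * pminus rp)
      + 2 * rQ rp * (rho2 a rp (theta z) + 2 * M * rp) * E); first by ring.
    rewrite pE [2 * rQ rp * _]mulrC divfK; last by rewrite gt_eqF// mulr_gt0.
    rewrite /rC /radC; have -> : rp ^+ 2 + a ^+ 2 + 2 * M * rp = 4 * M * rp.
      by move/eqP: hp; rewrite /horizon -/rp => /eqP hp; lra.
    by rewrite /rQ /radQ; ring.
  have S0 := S_gt0 (lexx rp).
  by rewrite addr_gt0// !mulr_gt0.
have minus_path r r' : rp <= r -> r <= r' -> r' <= r0 ->
    connected_component A (lift r (pminus r)) (lift r' (pminus r')).
  move=> rpr rr' r'r0.
  apply: (@path_connected_component R (phase R) A (fun x => lift x (pminus x)))
    => //.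
    apply: cvg_within_continuous => x; rewrite /= in_itv/= => /andP[rx _].
    apply: cvg_lift; rewrite /pminus; cvg_tac;
      [exact: cvgC| |exact: cvgQ|exact: cvgR].
    by apply/lt0r_neq0/QR_gt0/(le_trans rpr).
  by move=> x /andP[rx xr']; apply: minus_level;
    rewrite (le_trans rpr)// (le_trans xr').
have r0p : rp < r0 := lt_le_trans rpz sr0.
exists (lift rp (pminus rp)) => //.
have : p_r z = pminus s \/ p_r z = pplus s.
  have hs : hz s != 0 by rewrite gt_eqF// horizon_gt0.
  have : (hz s * p_r z - rQ s) ^+ 2 = Num.sqrt (rR s) ^+ 2.
    by rewrite w2 sqr_sqrtr// Rge0// (ltW rpz).
  move=> /eqP; rewrite eqf_sqr => /orP[|] /eqP ws; [right|left].
    by apply: (mulfI hs); apply: (addIr (- rQ s)); rewrite ws pplusE.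
  by apply: (mulfI hs); apply: (addIr (- rQ s)); rewrite ws pminusE// (ltW rpz).
(* On the ingoing branch the path runs straight to the horizon. On the other one it first climbs to
   [r0], where [radR = 0] makes the branches meet. *)
case=> [/sE ->|/sE ->].
  by apply: connected_component_sym; apply: minus_path => //; exact: ltW.
apply: (@connected_component_trans _ _ (lift r0 (pminus r0))); last first.
  by apply: connected_component_sym; apply: minus_path => //; exact: ltW.
have -> : pminus r0 = pplus r0.
  have h0 : hz r0 != 0 by rewrite gt_eqF// horizon_gt0.
  have R0 : rR r0 = 0 by rewrite /rR RE Gr0 mulr0.
  apply: (mulfI h0); apply: (addIr (- rQ r0)).
  by rewrite pplusE// pminusE ?(ltW r0p)//= R0 sqrtr0 oppr0.
apply: (@path_connected_component R (phase R) A (fun x => lift x (pplus x)))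
  => //.
  apply: cvg_within_continuous => x; rewrite /= in_itv/= => /andP[sx _].
  apply: cvg_lift; rewrite /pplus; cvg_tac;
    [exact: cvgQ|exact: cvgR| |exact: cvgH].
  by apply/lt0r_neq0/(horizon_gt0 M0 al01)/(lt_le_trans rpz).
move=> x /andP[sx xr0]; have rpx := lt_le_trans rpz sx.
by apply: lift_level => //; rewrite pplusE// sqr_sqrtr// Rge0// (ltW rpx).
Qed.

End HorizonReaching.

(** * Existence, uniqueness and topology of the exterior component *)

Theorem proposition3 (R : realType) (M_H a_H : R) (M_H_gt0 : 0 < M_H)
    (alpha_range : 0 <= a_H / M_H < 1)
    (m E Lz L : R) (q_Omega : Omega M_H a_H (m, E, Lz, L)) :
  exists C : set (phase R),
    [/\ is_component (Gamma_level M_H a_H m E Lz L) C,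
        C `<=` exterior M_H a_H,
        (forall C' : set (phase R),
            is_component (Gamma_level M_H a_H m E Lz L) C' ->
            C' `<=` exterior M_H a_H -> C' = C) &
        homeomorphic C (@R_times_T3 R)].
Proof.
have [beta [g [s [[be01 m0 L0 E01] LzE Lz0 /andP[rpg gs] [Pg Rg Rs]]]]] :=
  Omega_data M_H_gt0 alpha_range q_Omega.
have [r1 [r2 [d [e /= [gr1 r12 RE Gp Gg]]]]] :=
  radial_data M_H_gt0 alpha_range E01 rpg gs Rg Rs.
rewrite {}LzE in Lz0 *.
have [u0 [b0 [d0 [u01 TE Tpos]]]] := polT_factor be01 L0 E01 Lz0.
pose z0 := base_point M_H a_H m E beta L r1 r2 d e u0 b0 d0.
have [Az0 gz0] : Gamma_level M_H a_H m E
  (beta * L + a_H * E) L z0 /\ g < radius z0.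
  exact: base_point_level.
have CE : connected_component (Gamma_level M_H a_H m E
  (beta * L + a_H * E) L) z0 =
    Gamma_level M_H a_H m E (beta * L + a_H * E) L `&` [set z | g < radius z].
  exact: base_component.
exists (connected_component (Gamma_level M_H a_H m E
  (beta * L + a_H * E) L) z0).
split; first by exists z0.
- by rewrite CE => z [_ gz]; exact: lt_trans gz.
(* A component that stays in the exterior has no point with radius below [g], as it would reach
   [r_plus], and none at [g]; so it meets, and hence equals, the component beyond [g]. *)
- move=> _ [z Az ->] Cext; apply/esym/same_connected_component.
  rewrite CE; split => //=; rewrite ltNge le_eqVlt;
    apply/negP => /orP[/eqP zg|zg].
    by have := level_gap M_H_gt0 alpha_range m0 rpg gr1 r12 RE Gg Az;
      rewrite zg eqxx.
  have rpz : r_plus M_H a_H < radius z by exact/Cext/connected_component_refl.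
  have [z' /Cext] := level_reaches_horizon M_H_gt0 alpha_range m0 E01 gr1 r12
    RE Gp Gg Az rpz zg.
  by rewrite /exterior /= => + zE; rewrite zE ltxx.
- exact: (base_component_torus M_H_gt0 alpha_range m0 E01 rpg gr1 r12 RE Gp Gg
  Pg).
Qed.
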